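(* Let $\rho\in\mathcal{D}_{=}(SLE)$ and let $|\rho\rangle\langle\rho|_{SLEP}$ be a purification of $\rho_{SLE}$. Let $\delta\ge 0$. Suppose there exist finite-dimensional registers $X,Y,Q$, a state $\rho_{XY}\in\mathcal{D}_{=}(XY)$, and channels $\mathcal{E}:LPX\to PQ$ (encoding) and $\mathcal{D}:QEY\to LE$ (decoding) such that $$P\big(\rho_{SLEP},\,(\mathcal{D}\circ\mathcal{E})(|\rho\rangle\langle\rho|_{SLEP}\otimes\rho_{XY})\big)\le\delta$$ (i.e. a $\delta$-quantum state redistribution protocol for $\rho$ in which Alice holds $PL$, Bob initially holds $E$, the reference holds $S$, the register to be transmitted is $L$, and $Q$ is the message register). Then for any $\epsilon\in[0,1)$ with $\epsilon+\delta<1$, $$H_{\min}^{\uparrow,\epsilon+\delta}(S|LE)_\rho\ \ge\ H_{\min}^{\uparrow,\epsilon}(S|E)_\rho-2\log|Q|.$$ If moreover the register $Q$ is classical (the output of $\mathcal{E}$ is always classical on $Q$), then $2\log|Q|$ may be replaced by $\log|Q|$.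
   Context: All registers are finite-dimensional; $\log$ is base $2$; $|Q|$ is the dimension of $Q$. $\mathcal{D}_{=}(A)$ (resp. $\mathcal{D}_{\le}(A)$) denotes normalized (resp. subnormalized) density operators on $A$, $\mathrm{Pos}(A)$ the positive semidefinite operators. Identity channels on untouched registers are left implicit. For $\rho,\sigma\in\mathcal{D}_{\le}(A)$ the generalized fidelity is $F(\rho,\sigma)=\|\sqrt\rho\sqrt\sigma\|_1+\sqrt{(1-\mathrm{Tr}\rho)(1-\mathrm{Tr}\sigma)}$ and the purified distance is $P(\rho,\sigma)=\sqrt{1-F(\rho,\sigma)^2}$. The max-divergence is $D_\infty(\rho\|\sigma)=\log\inf\{\mu\ge0:\rho\le\mu\sigma\}$ ($+\infty$ if no such $\mu$). $H^\uparrow_\infty(A|B)_\rho=-\inf_{\sigma_B\in\mathcal{D}_{\le}(B)}D_\infty(\rho_{AB}\|\mathbb{1}_A\otimes\sigma_B)$, and for $\epsilon\in[0,\sqrt{\mathrm{Tr}\rho})$ the smooth min-entropy is $H_{\min}^{\uparrow,\epsilon}(A|B)_\rho=\sup\{H^\uparrow_\infty(A|B)_{\tilde\rho}:\tilde\rho\in\mathcal{D}_{\le}(AB),P(\tilde\rho,\rho)\le\epsilon\}$. *)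

(* Defs.v *)
From HB Require Import structures.
From mathcomp Require Import all_boot all_order all_algebra.
From mathcomp Require Import all_classical all_reals all_analysis.
From mathcomp Require Import complex.
From Stdlib Require ClassicalEpsilon.

Set Implicit Arguments.
Unset Strict Implicit.
Unset Printing Implicit Defensive.

Import Order.TTheory GRing.Theory Num.Theory.
Local Open Scope ring_scope.

(* Registers are finite types (their elements index a computational basis).
   An operator on register T is a T x T complex matrix, represented as a
   function T -> T -> R[i]. Composite register AB is the product type A * B. *)
Definition Op (R : realType) (T : finType) := T -> T -> R[i].
Definition Vec (R : realType) (T : finType) := T -> R[i].
Arguments Op R T%_type.
Arguments Vec R T%_type.

Section QInfo.
Variable R : realType.
Local Notation C := (R[i]).

Definition toC (x : R) : C := Complex x 0.

Definition opmul (T : finType) (A B : Op R T) : Op R T :=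
  fun i j => \sum_k A i k * B k j.
Definition adj (T : finType) (A : Op R T) : Op R T := fun i j => (A j i)^*.
Definition tr (T : finType) (A : Op R T) : C := \sum_i A i i.
Definition idop (T : finType) : Op R T := fun i j => (i == j)%:R.
Definition tens (T1 T2 : finType) (A : Op R T1) (B : Op R T2) : Op R (T1 * T2) :=
  fun i j => A i.1 j.1 * B i.2 j.2.
Definition ketbra (T : finType) (v : Vec R T) : Op R T := fun i j => v i * (v j)^*.
Definition ptr2 (T1 T2 : finType) (M : Op R (T1 * T2)) : Op R T1 :=
  fun i j => \sum_k M (i, k) (j, k).

(* positive semidefinite: <v, A v> is real and >= 0 for every vector v
   (the order on R[i] is the numClosedField order: 0 <= z iff z real >= 0) *)
Definition psd (T : finType) (A : Op R T) : Prop :=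
  forall v : Vec R T, 0 <= \sum_i \sum_j (v i)^* * A i j * v j.
Definition leop (T : finType) (A B : Op R T) : Prop := psd (fun i j => B i j - A i j).

Definition dens_eq (T : finType) (rho : Op R T) : Prop := psd rho /\ tr rho = 1.
Definition dens_le (T : finType) (rho : Op R T) : Prop := psd rho /\ tr rho <= 1.

(* the positive semidefinite square root (unique for psd A) *)
Definition psd_sqrt (T : finType) (A : Op R T) : Op R T :=
  ClassicalEpsilon.epsilon (inhabits (fun _ _ => 0))
    (fun B => psd B /\ opmul B B = A).

Definition trnorm (T : finType) (A : Op R T) : R :=
  complex.Re (tr (psd_sqrt (opmul (adj A) A))).

Definition fid (T : finType) (rho sigma : Op R T) : R :=
  trnorm (opmul (psd_sqrt rho) (psd_sqrt sigma))
  + Num.sqrt ((1 - complex.Re (tr rho)) * (1 - complex.Re (tr sigma))).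
Definition Pdist (T : finType) (rho sigma : Op R T) : R :=
  Num.sqrt (1 - fid rho sigma ^+ 2).

Definition log2 (x : R) : R := ln x / ln 2.
Definition elog2 (x : R) : \bar R := if x == 0 then -oo%E else (log2 x)%:E.

Definition Dmax (T : finType) (rho sigma : Op R T) : \bar R :=
  let S : set R := fun mu => 0 <= mu /\ leop rho (fun i j => toC mu * sigma i j) in
  if `[< exists mu, S mu >] then elog2 (inf S) else +oo%E.

Definition Hup (A B : finType) (rho : Op R (A * B)) : \bar R :=
  (- ereal_inf [set Dmax rho (tens (@idop A) sigma) | sigma in [set s : Op R B | dens_le s]]%classic)%E.

Definition Hsmooth (A B : finType) (eps : R) (rho : Op R (A * B)) : \bar R :=
  ereal_sup [set Hup rt | rt in [set rt : Op R (A * B) | dens_le rt /\ Pdist rt rho <= eps]]%classic.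

Definition linmap (T1 T2 : finType) (F : Op R T1 -> Op R T2) : Prop :=
  forall (a : C) (M N : Op R T1),
    F (fun i j => a * M i j + N i j) = (fun i j => a * F M i j + F N i j).
Definition tpres (T1 T2 : finType) (F : Op R T1 -> Op R T2) : Prop :=
  forall M, tr (F M) = tr M.
Definition ext_id (Z T1 T2 : finType) (F : Op R T1 -> Op R T2)
    (M : Op R (Z * T1)) : Op R (Z * T2) :=
  fun i j => F (fun a b => M (i.1, a) (j.1, b)) i.2 j.2.
Definition cpos (T1 T2 : finType) (F : Op R T1 -> Op R T2) : Prop :=
  forall (n : nat) (M : Op R ('I_n * T1)), psd M -> psd (ext_id F M).
Definition channel (T1 T2 : finType) (F : Op R T1 -> Op R T2) : Prop :=
  [/\ linmap F, tpres F & cpos F].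

Definition apply_left (T1 T2 Rst : finType) (F : Op R T1 -> Op R T2)
    (M : Op R (T1 * Rst)) : Op R (T2 * Rst) :=
  fun i j => F (fun a b => M (a, i.2) (b, j.2)) i.1 j.1.

Definition reindex (T1 T2 : finType) (g : T1 -> T2) (M : Op R T2) : Op R T1 :=
  fun i j => M (g i) (g j).

Definition qsr_output (S L E P X Y Q : finType) (psi : Vec R ((S * (L * E)) * P))
    (rhoXY : Op R (X * Y))
    (Enc : Op R ((L * P) * X) -> Op R (P * Q))
    (Dec : Op R ((Q * E) * Y) -> Op R (L * E)) : Op R ((S * (L * E)) * P) :=
  let w0 := tens (ketbra psi) rhoXY in
  let w1 := reindex (fun t : ((L * P) * X) * ((S * E) * Y) =>
              let '((l, p, x), (s, e, y)) := t in (((s, (l, e)), p), (x, y))) w0 in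
  let w2 := apply_left Enc w1 in
  let w3 := reindex (fun t : ((Q * E) * Y) * (S * P) =>
              let '((q, e, y), (s, p)) := t in ((p, q), (s, e, y))) w2 in
  let w4 := apply_left Dec w3 in
  reindex (fun t : (S * (L * E)) * P =>
              let '((s, (l, e)), p) := t in ((l, e), (s, p))) w4.

Definition trace_mid (S L E : finType) (rho : Op R (S * (L * E))) : Op R (S * E) :=
  fun i j => \sum_l rho (i.1, (l, i.2)) (j.1, (l, j.2)).

Definition classical_out (T P Q : finType) (F : Op R T -> Op R (P * Q)) : Prop :=
  forall M p p' (q q' : Q), q != q' -> F M (p, q) (p', q') = 0.

End QInfo.

(* Main.v *)
Require Import Defs.
From HB Require Import structures.
From mathcomp Require Import all_boot all_order all_algebra.
From mathcomp Require Import all_classical all_reals all_analysis.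
From mathcomp Require Import complex.
From mathcomp Require Import ring lra.
From Stdlib Require ClassicalEpsilon.
Set Implicit Arguments.
Unset Strict Implicit.
Unset Printing Implicit Defensive.
Import Order.TTheory GRing.Theory Num.Theory.
Local Open Scope ring_scope.

(** The fidelity [F(A, B)] is the maximum of [Re (tr X)] over the couplings
    of [A] and [B], i.e. the [X] for which the block matrix
    [[A, X], [X^*, B]] is psd. Read this way it is monotone under channels by
    complete positivity alone. A psd block has [X = A K] and
    [K^* A K <= B], so two couplings through a common middle state [B] glue to
    [K1^* B K2] (triangle inequality for the purified distance), and a
    coupling of a marginal of [w] lifts to [w] by letting [K] act on it
    (Uhlmann's theorem).

    Let [rt] be nearly optimal for the smooth min-entropy of [S|E], with
    [rt <= mu 1_S (x) sig]. The encoder does not touch [S], [E], [Y], so the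
    encoded state has marginal [rho_SE (x) rho_Y]; lift [rt (x) rho_Y] to a
    state [w] on [Q S E Y] close to it. Then
    [w <= |Q| 1_Q (x) rt (x) rho_Y], the factor [|Q|] being superfluous when
    [Q] is classical, and decoding [w] gives a state close to [rho] and
    dominated by [|Q|^2 mu 1_S (x) sig'], where [sig'] is the decoder's output
    on the maximally mixed message. *)

(** * Positive semidefinite matrices and their couplings *)

Section PsdMatrices.
Local Open Scope sesquilinear_scope.
Variable C : numClosedFieldType.

Lemma adjmxM m n p (A : 'M[C]_(m, n)) (B : 'M[C]_(n, p)) :
  (A *m B)^t* = B^t* *m A^t*.
Proof. by rewrite trmx_mul map_mxM. Qed.

Lemma adjmxD m n (A B : 'M[C]_(m, n)) : (A + B)^t* = A^t* + B^t*.
Proof. by apply/matrixP=> i j; rewrite !mxE rmorphD. Qed.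

Lemma adjmxB m n (A B : 'M[C]_(m, n)) : (A - B)^t* = A^t* - B^t*.
Proof. by apply/matrixP=> i j; rewrite !mxE rmorphB. Qed.

Lemma adjmxZ m n c (A : 'M[C]_(m, n)) : (c *: A)^t* = c^* *: A^t*.
Proof. by apply/matrixP=> i j; rewrite !mxE rmorphM. Qed.

Lemma adjmx1 n : (1%:M : 'M[C]_n)^t* = 1%:M.
Proof. by rewrite trmx1 map_mx1. Qed.

Lemma mxtrace_adj n (A : 'M[C]_n) : \tr (A^t*) = (\tr A)^*.
Proof. by rewrite rmorph_sum; apply: eq_bigr => i _; rewrite !mxE. Qed.

(** Hermitian symmetry is not built in; over complex scalars it follows from the form being real
    ([psdmx_herm]). *)
Definition psdmx n (A : 'M[C]_n) : Prop :=
  forall v : 'cV[C]_n, 0 <= (v^t* *m A *m v) 0 0.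

Lemma psdmx_cong m n (N : 'M[C]_(n, m)) (A : 'M[C]_n) :
  psdmx A -> psdmx (N^t* *m A *m N).
Proof. by move=> hA v; have := hA (N *m v); rewrite adjmxM !mulmxA. Qed.

Lemma psdmxD n (A B : 'M[C]_n) : psdmx A -> psdmx B -> psdmx (A + B).
Proof.
by move=> hA hB v; rewrite mulmxDr mulmxDl mxE; apply: addr_ge0.
Qed.

Lemma psdmx1 n : psdmx (1%:M : 'M[C]_n).
Proof.
move=> v; rewrite mulmx1 mxE; apply: sumr_ge0 => i _.
by rewrite !mxE mulrC mul_conjC_ge0.
Qed.

Lemma psdmx_gram m n (N : 'M[C]_(m, n)) : psdmx (N^t* *m N).
Proof. by have := psdmx_cong N (@psdmx1 m); rewrite mulmx1. Qed.

Lemma psdmx_diag_ge0 n (A : 'M[C]_n) i : psdmx A -> 0 <= A i i.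
Proof.
move=> /(_ (delta_mx i 0)).
rewrite trmx_delta map_delta_mx -rowE -colE.
by rewrite !mxE.
Qed.

Lemma psdmx_tr_ge0 n (A : 'M[C]_n) : psdmx A -> 0 <= \tr A.
Proof. by move=> hA; apply: sumr_ge0 => i _; apply: psdmx_diag_ge0. Qed.

(** The trace is the sum of the squared moduli of the entries of [N]. This is the standard device
    below for showing that a matrix vanishes. *)
Lemma gram_tr_eq0 m n (N : 'M[C]_(m, n)) : \tr (N^t* *m N) = 0 -> N = 0.
Proof.
move=> h; apply/matrixP => i j; rewrite mxE; apply/eqP.
have ge k l : 0 <= (N^t*) k l * N l k by rewrite !mxE mulrC mul_conjC_ge0.
move: h => /eqP; rewrite psumr_eq0; last first.
  by move=> k _; rewrite mxE; apply: sumr_ge0 => l _; apply: ge.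
move=> /allP /(_ j (mem_index_enum _)) /=; rewrite mxE psumr_eq0 //.
move=> /allP /(_ i (mem_index_enum _)) /=.
by rewrite !mxE mulrC mul_conjC_eq0.
Qed.

(** Polarization: [u + v] shows that [q u v] is antisymmetric, and replacing [u] by ['i *: u] shows
    that it is symmetric. *)
Lemma mxform_eq0 n (B : 'M[C]_n) :
  (forall v : 'cV[C]_n, (v^t* *m B *m v) 0 0 = 0) -> B = 0.
Proof.
pose q (u v : 'cV[C]_n) := (u^t* *m B *m v) 0 0.
move=> qB; have addmx00 (M N : 'M[C]_1) : (M + N) 0 0 = M 0 0 + N 0 0.
  by rewrite mxE.
have scalemx00 c (M : 'M[C]_1) : (c *: M) 0 0 = c * M 0 0 by rewrite mxE.
have qD u v : q u v + q v u = 0.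
  have := qB (u + v).
  rewrite adjmxD !(mulmxDl, mulmxDr) !addmx00 !qB.
  by rewrite add0r addr0 addrC.
have q0 u v : q u v = 0.
  have e1 := qD u v; have := qD ('i *: u) v.
  rewrite /q adjmxZ -!scalemxAl -scalemxAr !scalemx00 -!/(q _ _) conjCi mulNr.
  rewrite addrC -mulrBr => /eqP; rewrite mulf_eq0 (negPf (neq0Ci _)) /= subr_eq0 => /eqP e2.
  by move/eqP: e1; rewrite e2 -mulr2n mulrn_eq0 /= => /eqP.
apply/matrixP => i j; have := q0 (delta_mx i 0) (delta_mx j 0).
by rewrite /q trmx_delta map_delta_mx -rowE -colE !mxE.
Qed.

Lemma psdmx_herm n (A : 'M[C]_n) : psdmx A -> A^t* = A.
Proof.
move=> hA; apply/eqP; rewrite -subr_eq0; apply/eqP/mxform_eq0 => v.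
have /geC0_conj h := hA v.
have adjmx00 (M : 'M[C]_1) : (M^t* - M) 0 0 = (M 0 0)^* - M 0 0 by rewrite !mxE.
suff -> : v^t* *m (A^t* - A) *m v = (v^t* *m A *m v)^t* - v^t* *m A *m v.
  by rewrite adjmx00 h subrr.
by rewrite mulmxBr mulmxBl !adjmxM trmxCK !mulmxA.
Qed.

(** A psd matrix is Hermitian, hence normal, so it is unitarily diagonalizable; the eigenvalues are
    diagonal entries of the psd matrix [U A U^*]. *)
Lemma psdmx_spectral n (A : 'M[C]_n) : psdmx A ->
  exists (U : 'M[C]_n) (d : 'rV[C]_n), [/\ U *m U^t* = 1%:M,
    A = U^t* *m diag_mx d *m U & forall i, 0 <= d 0 i].
Proof.
move=> hA; have An : A \is normalmx.
  by apply/normalmxP; rewrite psdmx_herm.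
have Uu := spectral_unitarymx A; have /orthomx_spectralP eA := An.
rewrite invmx_unitary // in eA.
exists (spectralmx A), (spectral_diag A); split=> //; first exact/unitarymxP.
move=> i; set U := spectralmx A in eA Uu *; set d := spectral_diag A in eA *.
have UU : U *m U^t* = 1%:M by apply/unitarymxP.
have -> : d 0 i = (U *m A *m U^t*) i i.
  by rewrite eA !mulmxA UU mul1mx -mulmxA UU mulmx1 mxE eqxx.
have := psdmx_cong (U^t*) hA; rewrite trmxCK => h.
exact: psdmx_diag_ge0.
Qed.

Lemma psdmx_sqrt n (A : 'M[C]_n) : psdmx A ->
  exists B, psdmx B /\ B *m B = A.
Proof.
move=> /psdmx_spectral [U [d [UU -> d0]]].
pose s := map_mx sqrtC d.
exists (U^t* *m diag_mx s *m U); split.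
  apply: psdmx_cong => v; rewrite -mulmxA mxE; apply: sumr_ge0 => i _.
  rewrite mul_diag_mx !mxE mulrCA; apply: mulr_ge0; first by rewrite sqrtC_ge0.
  by rewrite mulrC mul_conjC_ge0.
rewrite !mulmxA -[_ *m U *m U^t*]mulmxA UU mulmx1; congr (_ *m _).
rewrite -mulmxA mulmx_diag; congr (_ *m diag_mx _).
by apply/rowP => i; rewrite !mxE -expr2 sqrtCK.
Qed.

(* The Moore-Penrose inverse of a psd matrix: [A *m G] is the orthogonal
   projection onto the range of [A]. *)
Lemma psdmx_pinv n (A : 'M[C]_n) : psdmx A ->
  exists G, [/\ G^t* = G, A *m G = G *m A & A *m G *m A = A].
Proof.
move=> /psdmx_spectral [U [d [UU -> d0]]].
(* The convention [0^-1 = 0] leaves zero eigenvalues at zero, as a pseudo-inverse requires. *)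
pose s := map_mx (fun x => x^-1) d.
have D (a b : 'rV_n) : (U^t* *m diag_mx a *m U) *m (U^t* *m diag_mx b *m U)
    = U^t* *m diag_mx (\row_i (a 0 i * b 0 i)) *m U.
  rewrite !mulmxA -[_ *m U *m U^t*]mulmxA UU mulmx1; congr (_ *m _).
  by rewrite -mulmxA mulmx_diag.
exists (U^t* *m diag_mx s *m U); split.
- rewrite !adjmxM trmxCK mulmxA tr_diag_mx map_diag_mx; congr (_ *m diag_mx _ *m _).
  by apply/rowP => i; rewrite !mxE; apply: geC0_conj; rewrite invr_ge0.
- rewrite !D; congr (_ *m diag_mx _ *m _).
  by apply/rowP => i; rewrite !mxE mulrC.
- rewrite !D; congr (_ *m diag_mx _ *m _); apply/rowP => i; rewrite !mxE.
  have [->|nz] := eqVneq (d 0 i) 0; first by rewrite !mulr0.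
  by rewrite mulfV // mul1r.
Qed.

(** * Contractions and the polar decomposition *)

Lemma mx_addE m n (A B : 'M[C]_(m, n)) i j : (A + B) i j = A i j + B i j.
Proof. by rewrite mxE. Qed.

Lemma mx_oppE m n (A : 'M[C]_(m, n)) i j : (- A) i j = - A i j.
Proof. by rewrite mxE. Qed.

Definition contraction n (G : 'M[C]_n) := psdmx (1%:M - G^t* *m G).

Lemma contraction_mul n (G H : 'M[C]_n) :
  contraction G -> contraction H -> contraction (G *m H).
Proof.
move=> hG hH; rewrite /contraction.
suff -> : 1%:M - (G *m H)^t* *m (G *m H)
    = (1%:M - H^t* *m H) + H^t* *m (1%:M - G^t* *m G) *m H.
  by apply: psdmxD => //; apply: psdmx_cong.
by rewrite adjmxM mulmxBr mulmxBl mulmx1 !mulmxA addrA subrK.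
Qed.

(** Partial isometries are contractions: [1 - G^* G] is a projection, hence its own Gram matrix. *)
Lemma contraction_proj n (G : 'M[C]_n) :
  (G^t* *m G) *m (G^t* *m G) = G^t* *m G -> contraction G.
Proof.
set P := G^t* *m G => PP; rewrite /contraction -/P.
have Ph : P^t* = P by rewrite /P adjmxM trmxCK.
have -> : 1%:M - P = (1%:M - P)^t* *m (1%:M - P).
  rewrite adjmxB adjmx1 Ph mulmxBr mulmx1 mulmxBl mul1mx PP.
  by rewrite subrr subr0.
exact: psdmx_gram.
Qed.

(* If [S] plays the role of [|M|], this is the polar decomposition [M = V S]
   with [V] a partial isometry. *)
Lemma polar_decomposition n (M S : 'M[C]_n) : psdmx S -> S *m S = M^t* *m M ->
  exists V, [/\ contraction V, contraction (V^t*), V^t* *m M = S & V *m S = M].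
Proof.
move=> hS eS; have Sh := psdmx_herm hS.
have [G [Gh GC SGS]] := psdmx_pinv hS.
pose P := S *m G.
have PP : P *m P = P by rewrite /P mulmxA SGS.
have PE : G *m S = P by rewrite /P GC.
(* As [M^* M = S^2], the kernel of [S] lies in that of [M]: the Gram matrix of [M (P - 1)] vanishes
   because [S (P - 1) = 0]. *)
have MP : M *m P = M.
  have SP : S *m P = S by rewrite -PE mulmxA -/P /P SGS.
  apply/eqP; rewrite -subr_eq0; apply/eqP/gram_tr_eq0.
  have -> : M *m P - M = M *m (P - 1%:M) by rewrite mulmxBr mulmx1.
  rewrite adjmxM mulmxA -(mulmxA _ _ M) -eS -!mulmxA.
  by rewrite mulmxBr mulmx1 SP subrr !mulmx0 linear0.
exists (M *m G); have VM : (M *m G)^t* *m M = S.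
  by rewrite adjmxM Gh -mulmxA -eS mulmxA PE /P SGS.
have VV : (M *m G)^t* *m (M *m G) = P by rewrite mulmxA VM.
have VS : M *m G *m S = M by rewrite -mulmxA PE.
split=> //; apply: contraction_proj; first by rewrite VV.
have VP : M *m G *m P = M *m G by rewrite /P mulmxA VS.
by rewrite trmxCK mulmxA -(mulmxA _ ((M *m G)^t*) (M *m G)) VV VP.
Qed.

(** The matrix [2 - G - G^*] is psd, being [(1 - G)^* (1 - G) + (1 - G^* G)]; sandwich it with the
    square root of [S] and take the trace. *)
Lemma contraction_tr_le n (G S : 'M[C]_n) : contraction G -> psdmx S ->
  \tr (G *m S) + (\tr (G *m S))^* <= 2 * \tr S.
Proof.
move=> hG hS; have [s [hs eS]] := psdmx_sqrt hS.
have sh := psdmx_herm hs.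
have h : psdmx ((1%:M - G)^t* *m (1%:M - G) + (1%:M - G^t* *m G)).
  by apply: psdmxD => //; apply: psdmx_gram.
have := psdmx_tr_ge0 (psdmx_cong s h).
suff -> : \tr (s^t* *m ((1%:M - G)^t* *m (1%:M - G) + (1%:M - G^t* *m G)) *m s)
    = 2 * \tr S - (\tr (G *m S) + (\tr (G *m S))^*) by rewrite subr_ge0.
rewrite mxtrace_mulC sh mulmxA eS -mxtrace_adj adjmxM (psdmx_herm hS).
have -> : (1%:M - G)^t* *m (1%:M - G) + (1%:M - G^t* *m G)
    = 1%:M + 1%:M - G - G^t*.
  rewrite adjmxB adjmx1 mulmxBr mulmx1 mulmxBl mul1mx.
  by apply/matrixP => i j; rewrite !(mx_addE, mx_oppE); ring.
rewrite !mulmxBr mulmxDr mulmx1 !linearB linearD /= (mxtrace_mulC S G).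
by ring.
Qed.

(** Positivity of the block matrix [[[A, X], [X^*, B]]], written out as its quadratic form at the
    stacked vector [(u, w)]. *)
Definition blkpsd n (A X B : 'M[C]_n) : Prop := forall u w : 'cV[C]_n,
  0 <= (u^t* *m A *m u + u^t* *m X *m w + w^t* *m X^t* *m u + w^t* *m B *m w) 0 0.

Lemma blkpsd_cong m n (A X B : 'M[C]_n) (N K : 'M[C]_(n, m)) : blkpsd A X B ->
  psdmx (N^t* *m A *m N + N^t* *m X *m K + K^t* *m X^t* *m N + K^t* *m B *m K).
Proof.
move=> h v; have := h (N *m v) (K *m v).
by rewrite !adjmxM !mulmxDr !mulmxDl !mulmxA.
Qed.

Lemma blkpsdC n (A X B : 'M[C]_n) : blkpsd A X B -> blkpsd B (X^t*) A.
Proof.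
move=> h u w; have := h w u; rewrite trmxCK !(mx_addE).
by congr (0 <= _); ring.
Qed.

Lemma blkpsd_l n (A X B : 'M[C]_n) : blkpsd A X B -> psdmx A.
Proof.
move=> h; have := blkpsd_cong 1%:M 0 h.
by rewrite trmx0 map_mx0 adjmx1 !(mul0mx, mulmx0, mul1mx, mulmx1, addr0).
Qed.

Lemma blkpsd_r n (A X B : 'M[C]_n) : blkpsd A X B -> psdmx B.
Proof. by move=> /blkpsdC /blkpsd_l. Qed.

Lemma psdmx_gram_le0 m n (N : 'M[C]_(m, n)) : psdmx (- (N^t* *m N)) -> N = 0.
Proof.
move=> /psdmx_tr_ge0 h; apply: gram_tr_eq0; apply/eqP.
rewrite eq_le psdmx_tr_ge0 ?andbT; last exact: psdmx_gram.
by rewrite -oppr_ge0 -linearN.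
Qed.

(** Schur complement. The part [Y] of [X] outside the range of [A] must vanish, so [K = G X] solves
    [X = A K], with [G] the pseudo-inverse of [A]. *)
Lemma blkpsd_schur n (A X B : 'M[C]_n) : blkpsd A X B ->
  exists K, X = A *m K /\ psdmx (B - K^t* *m A *m K).
Proof.
move=> h; have hA := blkpsd_l h; have hB := blkpsd_r h; have Ah := psdmx_herm hA.
have [G [Gh GC AGA]] := psdmx_pinv hA.
pose Y := X - A *m G *m X.
have AY : A *m Y = 0 by rewrite /Y mulmxBr GC !mulmxA AGA subrr.
have Y0 : Y = 0.
  apply: gram_tr_eq0; apply/eqP/negPn/negP => nz.
  have t0 : 0 < \tr (Y^t* *m Y).
    by rewrite lt_def nz psdmx_tr_ge0 //; apply: psdmx_gram.
  (* Since [A Y = 0], compressing the block along [(-c Y, 1)] gives the trace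
     [tr B - 2 c tr (Y^* Y)]; this [c] makes it [-(tr B + 2) < 0]. *)
  pose c := (\tr B + 1) / \tr (Y^t* *m Y).
  have c0 : 0 <= c by rewrite divr_ge0 ?(ltW t0) // addr_ge0 // psdmx_tr_ge0.
  have := psdmx_tr_ge0 (blkpsd_cong (- c *: Y) 1%:M h).
  have YX : Y^t* *m X = Y^t* *m Y.
    have : Y^t* *m (A *m G *m X) = 0.
      by rewrite !mulmxA -{1}Ah -adjmxM AY trmx0 map_mx0 !mul0mx.
    by rewrite {3}/Y mulmxBr => ->; rewrite subr0.
  have XY : X^t* *m Y = Y^t* *m Y.
    by rewrite -[LHS]trmxCK adjmxM trmxCK YX adjmxM trmxCK.
  rewrite adjmx1 !mulmx1 !mul1mx -mulmxA -!scalemxAr AY mulmx0 scaler0 add0r.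
  rewrite adjmxZ -scalemxAl YX XY rmorphN /= (geC0_conj c0).
  rewrite -scalerDr linearD /= linearZ /= linearD /=.
  have -> : - c * (\tr (Y^t* *m Y) + \tr (Y^t* *m Y)) = - 2 * (\tr B + 1).
    by rewrite /c; field; rewrite gt_eqF.
  have := psdmx_tr_ge0 hB => b0.
  have -> : - 2 * (\tr B + 1) + \tr B = - (\tr B + 2) by ring.
  by rewrite oppr_ge0; apply/negP; rewrite lt_geF // ltr_wpDl.
have XE : X = A *m (G *m X).
  by apply/eqP; rewrite -subr_eq0 mulmxA; apply/eqP.
exists (G *m X); split=> //; move: (G *m X) XE => K XE.
have := blkpsd_cong (- K) 1%:M h.
have -> : (- K)^t* = - K^t* by apply/matrixP => i j; rewrite !mxE rmorphN.
rewrite XE adjmx1 !(mulmx1, mul1mx, mulNmx, mulmxN) adjmxM Ah !mulmxA.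
by rewrite opprK subrr sub0r addrC.
Qed.

(** A coupling has the form [X = a W b] with [W] a contraction. With the polar decomposition
    [a b = V S] this gives [tr X = tr (V^* W S)], and [V^* W] is again a contraction. *)
Lemma blkpsd_tr_le n (A X B a b S : 'M[C]_n) : blkpsd A X B ->
  psdmx a -> a *m a = A -> psdmx b -> b *m b = B ->
  psdmx S -> S *m S = (a *m b)^t* *m (a *m b) ->
  \tr X + (\tr X)^* <= 2 * \tr S.
Proof.
move=> hblk ha eA hb eB hS eS.
have ah := psdmx_herm ha; have bh := psdmx_herm hb.
have [V [V1 V2 VM VS]] := polar_decomposition hS eS.
have [K [XE hK]] := blkpsd_schur hblk.
have [G [Gh GC bGb]] := psdmx_pinv hb.
pose P := b *m G.
have Ph : P^t* = P by rewrite /P adjmxM Gh bh GC.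
have PP : P *m P = P by rewrite /P mulmxA bGb.
have KE : K^t* *m A *m K = (a *m K)^t* *m (a *m K) by rewrite adjmxM ah -eA !mulmxA.
(* [1 - P] projects onto the kernel of [b], where [K^* A K <= b^2] forces [a K] to vanish. Hence
   [a K] factors through [b]. *)
have aKP : a *m K *m (1%:M - P) = 0.
  apply: psdmx_gram_le0.
  have := psdmx_cong (1%:M - P) hK; rewrite KE -eB.
  have bP : b *m (1%:M - P) = 0.
    by rewrite mulmxBr mulmx1 /P GC mulmxA bGb subrr.
  rewrite -mulmxA mulmxBl -(mulmxA b) bP mulmx0 sub0r.
  by rewrite (adjmxM (a *m K)) mulmxN !mulmxA.
pose W := a *m K *m G.
have Wb : W *m b = a *m K.
  rewrite /W -mulmxA -GC -/P; apply/esym/eqP; rewrite -subr_eq0; apply/eqP.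
  by rewrite -aKP mulmxBr mulmx1.
have hW : contraction W.
  rewrite /contraction.
  suff -> : 1%:M - W^t* *m W
      = (1%:M - P)^t* *m (1%:M - P) + G^t* *m (B - K^t* *m A *m K) *m G.
    by apply: psdmxD; [apply: psdmx_gram | apply: psdmx_cong].
  have -> : (1%:M - P)^t* *m (1%:M - P) = 1%:M - P.
    by rewrite adjmxB adjmx1 Ph mulmxBr mulmx1 mulmxBl mul1mx PP subrr subr0.
  rewrite KE /W (adjmxM _ G) Gh mulmxBr mulmxBl -eB.
  have -> : G *m (b *m b) *m G = P by rewrite mulmxA -GC -/P -mulmxA -/P PP.
  by rewrite !mulmxA addrA subrK.
move: W Wb hW => W Wb hW.
have -> : \tr X = \tr (V^t* *m W *m S).
  rewrite XE -eA -mulmxA -Wb mxtrace_mulC -(mulmxA W).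
  have -> : b *m a = S *m V^t*.
    by rewrite -[LHS]trmxCK adjmxM ah bh -VS adjmxM (psdmx_herm hS).
  by rewrite mulmxA mxtrace_mulC mulmxA.
by apply: contraction_tr_le => //; apply: contraction_mul.
Qed.

(** The coupling [a V b] is optimal, where [a b = V S]: its trace is [tr ((a b)^* V) = tr S], and
    its block form is a square plus the defect [1 - V^* V]. *)
Lemma blkpsd_tr_attained n (A B a b S : 'M[C]_n) :
  psdmx a -> a *m a = A -> psdmx b -> b *m b = B ->
  psdmx S -> S *m S = (a *m b)^t* *m (a *m b) ->
  exists X, blkpsd A X B /\ \tr X = \tr S.
Proof.
move=> ha eA hb eB hS eS.
have ah := psdmx_herm ha; have bh := psdmx_herm hb.
have [V [V1 V2 VM VS]] := polar_decomposition hS eS.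
exists (a *m V *m b); split.
  move=> u w.
  have -> : u^t* *m A *m u + u^t* *m (a *m V *m b) *m w
      + w^t* *m (a *m V *m b)^t* *m u + w^t* *m B *m w
      = (a *m u + V *m b *m w)^t* *m (a *m u + V *m b *m w)
        + (b *m w)^t* *m (1%:M - V^t* *m V) *m (b *m w).
    rewrite -eA -eB adjmxD !adjmxM ah bh.
    rewrite !(mulmxDr, mulmxDl, mulmxN, mulNmx, mulmx1) !mulmxA.
    by apply/matrixP => i j; rewrite !(mx_addE, mx_oppE); ring.
  rewrite mx_addE; apply: addr_ge0; last exact: V1.
  by have := psdmx_gram (a *m u + V *m b *m w); apply: (@psdmx_diag_ge0 _ _ 0).
rewrite mxtrace_mulC -(psdmx_herm hS) -VM mulmxA.
by rewrite !adjmxM trmxCK ah bh.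
Qed.

(** * Cauchy-Schwarz and the gluing of couplings *)

Lemma real_discriminant (a b g : C) : 0 <= a -> 0 <= b -> g \is Num.real ->
  (forall t, t \is Num.real -> 0 <= a * t ^+ 2 + 2 * g * t + b) -> g ^+ 2 <= a * b.
Proof.
move=> a0 b0 gr h; have [ae|an] := eqVneq a 0.
  have [->|gn] := eqVneq g 0; first by rewrite expr0n mulr_ge0.
  have br : b + 1 \is Num.real by rewrite ger0_real // addr_ge0.
  (* For [a = 0] the polynomial is affine, and this [t] gives it the value [-1]; otherwise the
     vertex [- g / a] is used. *)
  have tr : - (b + 1) / (2 * g) \is Num.real by rewrite !(rpredM, rpredV, rpredN, realn).
  have := h _ tr; rewrite ae mul0r add0r.
  have -> : 2 * g * (- (b + 1) / (2 * g)) + b = - 1 by field.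
  by rewrite oppr_ge0 ler10.
have ap : 0 < a by rewrite lt_def an.
have tr : - g / a \is Num.real by rewrite !(rpredM, rpredV, rpredN) // ger0_real.
have := h _ tr.
have -> : a * (- g / a) ^+ 2 + 2 * g * (- g / a) + b = (a * b - g ^+ 2) / a by field.
by rewrite pmulr_lge0 ?invr_gt0 // subr_ge0.
Qed.

(** Cauchy-Schwarz for the real semi-inner product [Re tr (K^* B L)], from the discriminant of its
    value on [t K + L]. *)
Lemma psdmx_cauchy n (B K L : 'M[C]_n) : psdmx B ->
  ((\tr (K^t* *m B *m L) + (\tr (K^t* *m B *m L))^*) / 2) ^+ 2
    <= \tr (K^t* *m B *m K) * \tr (L^t* *m B *m L).
Proof.
move=> hB; set z := \tr (K^t* *m B *m L).
have zE : \tr (L^t* *m B *m K) = z^*.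
  by rewrite /z -mxtrace_adj !adjmxM trmxCK (psdmx_herm hB) mulmxA.
apply: real_discriminant.
- by apply: psdmx_tr_ge0; apply: psdmx_cong.
- by apply: psdmx_tr_ge0; apply: psdmx_cong.
- by rewrite rpredM ?rpredV ?realn // CrealE rmorphD /= conjCK addrC.
move=> t tr; have := psdmx_tr_ge0 (psdmx_cong (t *: K + L) hB).
rewrite adjmxD adjmxZ (CrealP tr) !(mulmxDl, mulmxDr).
rewrite -!scalemxAl -!scalemxAr !linearD /= !linearZ /= zE -/z.
by congr (0 <= _); field.
Qed.

(* Gluing along [B]: the compatible coupling of [A] and [D] is [K1^* B K2],
   and [g] is the real inner product of the two deviations [K_i - f_i]. *)
Lemma blkpsd_glue n (A B D X1 X2 : 'M[C]_n) (f1 f2 : C) :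
  blkpsd B X1 A -> blkpsd B X2 D -> \tr B = 1 -> \tr A <= 1 -> \tr D <= 1 ->
  \tr X1 = f1 -> \tr X2 = f2 -> f1 \is Num.real -> f2 \is Num.real ->
  exists Z g, [/\ blkpsd A Z D, \tr Z + (\tr Z)^* = 2 * (f1 * f2 + g),
    g \is Num.real, g ^+ 2 <= (1 - f1 ^+ 2) * (1 - f2 ^+ 2)
    & f1 ^+ 2 <= 1 /\ f2 ^+ 2 <= 1].
Proof.
move=> h1 h2 tB tA tD e1 e2 r1 r2.
have hB := blkpsd_l h1; have Bh := psdmx_herm hB.
have [K1 [E1 S1]] := blkpsd_schur h1; have [K2 [E2 S2]] := blkpsd_schur h2.
(* For the semi-inner product [tr (K^* B L)], [1] is a unit vector because [tr B = 1], and [f] is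
   the component of [K] along it; [dev] is the orthogonal remainder, of squared norm at most
   [1 - f^2]. *)
pose dev (K : 'M[C]_n) (f : C) := K - f *: 1%:M.
have devE K1' K2' f1' f2' : f1' \is Num.real -> f2' \is Num.real ->
    \tr (B *m K1') = f1' -> \tr (B *m K2') = f2' ->
    \tr ((dev K1' f1')^t* *m B *m dev K2' f2') = \tr (K1'^t* *m B *m K2') - f1' * f2'.
  move=> r1' r2' e1' e2'.
  have e1c : \tr (K1'^t* *m B) = f1'.
    by rewrite -[LHS]conjCK -mxtrace_adj adjmxM trmxCK Bh e1' (CrealP r1').
  rewrite adjmxB adjmxZ adjmx1 (CrealP r1') !(mulmxBl, mulmxBr).
  rewrite -!scalemxAl -!scalemxAr !mul1mx !mulmx1.
  rewrite !linearB /= !linearZ /= e1c e2' tB.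
  by ring.
have trle K f M : \tr (B *m K) = f -> f \is Num.real -> \tr M <= 1 ->
    psdmx (M - K^t* *m B *m K) ->
    \tr ((dev K f)^t* *m B *m dev K f) <= 1 - f ^+ 2.
  move=> e r tM /psdmx_tr_ge0; rewrite linearB subr_ge0 /= => le.
  by rewrite devE // expr2 lerD2r (le_trans le).
have ge0 K : 0 <= \tr (K^t* *m B *m K) by apply/psdmx_tr_ge0/psdmx_cong.
rewrite E1 in e1; rewrite E2 in e2.
have l1 := trle _ _ _ e1 r1 tA S1; have l2 := trle _ _ _ e2 r2 tD S2.
pose Z := K1^t* *m B *m K2.
exists Z, ((\tr Z + (\tr Z)^*) / 2 - f1 * f2); split.
- move=> u w.
  have -> : u^t* *m A *m u + u^t* *m Z *m w + w^t* *m Z^t* *m u + w^t* *m D *m w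
     = (K1 *m u + K2 *m w)^t* *m B *m (K1 *m u + K2 *m w)
       + (u^t* *m (A - K1^t* *m B *m K1) *m u + w^t* *m (D - K2^t* *m B *m K2) *m w).
    rewrite adjmxD /Z !adjmxM trmxCK Bh !(mulmxDr, mulmxDl, mulmxN, mulNmx) !mulmxA.
    by apply/matrixP => i j; rewrite !(mx_addE, mx_oppE); ring.
  rewrite !mx_addE addr_ge0 ?addr_ge0 //.
- by field.
- by rewrite rpredB ?rpredM ?rpredV ?realn // CrealE rmorphD /= conjCK addrC.
- have := psdmx_cauchy (dev K1 f1) (dev K2 f2) hB.
  rewrite {1 2}devE // -/Z rmorphB rmorphM /= (CrealP r1) (CrealP r2).
  rewrite (_ : (_ - _ + _) / 2 = (\tr Z + (\tr Z)^*) / 2 - f1 * f2); last by field.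
  by move=> le; apply: (le_trans le); apply: ler_pM.
- by split; rewrite -subr_ge0; [apply: (le_trans _ l1) | apply: (le_trans _ l2)].
Qed.

(** Converse of [blkpsd_schur], by completing the square at [u + K w]. *)
Lemma blkpsd_factor n (A K D : 'M[C]_n) : psdmx A -> psdmx D ->
  blkpsd A (A *m K) (K^t* *m A *m K + D).
Proof.
move=> hA hD u w.
have -> : u^t* *m A *m u + u^t* *m (A *m K) *m w + w^t* *m (A *m K)^t* *m u
    + w^t* *m (K^t* *m A *m K + D) *m w
  = (u + K *m w)^t* *m A *m (u + K *m w) + w^t* *m D *m w.
  rewrite adjmxD !adjmxM (psdmx_herm hA) !(mulmxDr, mulmxDl) !mulmxA.
  by apply/matrixP => i j; rewrite !mx_addE; ring.
by rewrite mx_addE addr_ge0.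
Qed.

End PsdMatrices.

(** * Operators on registers *)

Section Operators.
Local Open Scope sesquilinear_scope.
Variable R : realType.
Local Notation C := (R[i]).

Lemma opP (T : finType) (A B : Op R T) : (forall i j, A i j = B i j) -> A = B.
Proof. by move=> h; apply: funext => i; apply: funext => j. Qed.

(** Transport along the enumeration of the register, which makes the matrix results above available
    for operators. *)
Definition mxop (T : finType) (A : Op R T) : 'M[C]_#|T| :=
  \matrix_(i, j) A (enum_val i) (enum_val j).

Definition opmx (T : finType) (M : 'M[C]_#|T|) : Op R T :=
  fun i j => M (enum_rank i) (enum_rank j).

Lemma mxopK (T : finType) : cancel (@mxop T) (@opmx T).
Proof. by move=> A; apply: opP => i j; rewrite /opmx mxE !enum_rankK. Qed.

Lemma mxop_inj (T : finType) : injective (@mxop T).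
Proof. exact: can_inj (@mxopK T). Qed.

Lemma opmxK (T : finType) : cancel (@opmx T) (@mxop T).
Proof. by move=> M; apply/matrixP => i j; rewrite mxE /opmx !enum_valK. Qed.

Lemma sum_enum_val (T : finType) (F : T -> C) :
  \sum_(i < #|T|) F (enum_val i) = \sum_i F i.
Proof.
by rewrite [RHS](reindex (@enum_val T T)) //; apply/onW_bij/enum_val_bij.
Qed.

Lemma mxop_mul (T : finType) (A B : Op R T) : mxop (opmul A B) = mxop A *m mxop B.
Proof.
apply/matrixP => i j; rewrite !mxE /opmul -[LHS]sum_enum_val.
by apply: eq_bigr => k _; rewrite !mxE.
Qed.

Lemma mxop_adj (T : finType) (A : Op R T) : mxop (adj A) = (mxop A)^t*.
Proof. by apply/matrixP => i j; rewrite !mxE. Qed.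

Lemma mxtrace_mxop (T : finType) (A : Op R T) : \tr (mxop A) = tr A.
Proof. by rewrite /tr -[RHS]sum_enum_val; apply: eq_bigr => k _; rewrite mxE. Qed.

Definition colop (T : finType) (u : Vec R T) : 'cV[C]_#|T| := \col_i u (enum_val i).

Definition opcol (T : finType) (v : 'cV[C]_#|T|) : Vec R T := fun t => v (enum_rank t) 0.

Lemma opcolK (T : finType) : cancel (@opcol T) (@colop T).
Proof. by move=> v; apply/colP => i; rewrite mxE /opcol enum_valK. Qed.

Lemma mxop_form (T : finType) (A : Op R T) (u v : Vec R T) :
  ((colop u)^t* *m mxop A *m colop v) 0 0 = \sum_i \sum_j (u i)^* * A i j * v j.
Proof.
rewrite mxE [RHS]exchange_big /= -[RHS]sum_enum_val; apply: eq_bigr => j _.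
rewrite !mxE mulr_suml -[RHS]sum_enum_val; apply: eq_bigr => i _.
by rewrite !mxE.
Qed.

Lemma psdmx_mxop (T : finType) (A : Op R T) : psdmx (mxop A) <-> psd A.
Proof.
split=> h v; first by have := h (colop v); rewrite mxop_form.
by rewrite -(opcolK v) mxop_form.
Qed.

Lemma psd_herm (T : finType) (A : Op R T) : psd A -> adj A = A.
Proof.
by move=> /psdmx_mxop /psdmx_herm; rewrite -mxop_adj => /mxop_inj.
Qed.

Lemma psd_tr_ge0 (T : finType) (A : Op R T) : psd A -> 0 <= tr A.
Proof. by move=> /psdmx_mxop /psdmx_tr_ge0; rewrite mxtrace_mxop. Qed.

Lemma psd_sqrtP (T : finType) (A : Op R T) : psd A ->
  psd (psd_sqrt A) /\ opmul (psd_sqrt A) (psd_sqrt A) = A.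
Proof.
move=> hA; apply: (ClassicalEpsilon.epsilon_spec (inhabits (fun _ _ => 0))
  (fun B => psd B /\ opmul B B = A)).
have /psdmx_mxop /psdmx_sqrt [B [hB eB]] := hA.
exists (opmx B); split; first by apply/psdmx_mxop; rewrite opmxK.
by apply: mxop_inj; rewrite mxop_mul opmxK.
Qed.

(** The block matrix as an operator with an extra qubit [bool], so that complete positivity applies
    to couplings directly. *)
Definition blkop (T : finType) (A X B : Op R T) : Op R (bool * T) := fun i j =>
  match i.1, j.1 with
  | false, false => A i.2 j.2
  | false, true => X i.2 j.2
  | true, false => adj X i.2 j.2
  | true, true => B i.2 j.2
  end.

Lemma sum_bool_prod (T : finType) (F : bool * T -> C) :
  \sum_i F i = \sum_i F (false, i) + \sum_i F (true, i).
Proof.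
transitivity (\sum_p F (p.1, p.2)); first by apply: eq_bigr => -[].
by rewrite -(pair_bigA _ (fun b t => F (b, t))) /= big_bool addrC.
Qed.

Lemma psd_blkop (T : finType) (A X B : Op R T) :
  psd (blkop A X B) <-> blkpsd (mxop A) (mxop X) (mxop B).
Proof.
have form (u w : Vec R T) (v : Vec R (bool * T)) :
    (forall t, v (false, t) = u t) -> (forall t, v (true, t) = w t) ->
    \sum_i \sum_j (v i)^* * blkop A X B i j * v j =
    (\sum_i \sum_j (u i)^* * A i j * u j + \sum_i \sum_j (u i)^* * X i j * w j)
    + \sum_i \sum_j (w i)^* * adj X i j * u j + \sum_i \sum_j (w i)^* * B i j * w j.
  move=> vu vw; rewrite sum_bool_prod -addrA; congr (_ + _); rewrite -big_split /=;
    apply: eq_bigr => i _; rewrite sum_bool_prod ?vu ?vw;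
    by congr (_ + _); apply: eq_bigr => j _; rewrite ?vu ?vw.
split=> h.
  move=> u w; rewrite -(opcolK u) -(opcolK w) -mxop_adj 3!mx_addE 4!mxop_form.
  have := h (fun p => if p.1 then opcol w p.2 else opcol u p.2).
  by rewrite (form (opcol u) (opcol w)).
move=> v; rewrite (form (fun t => v (false, t)) (fun t => v (true, t))) //.
have := h (colop (fun t => v (false, t))) (colop (fun t => v (true, t))).
by rewrite -mxop_adj 3!mx_addE 4!mxop_form.
Qed.

(** * Fidelity as a maximum over couplings *)

Lemma ge0_toC (z : C) : 0 <= z -> z = toC (complex.Re z).
Proof. by move=> /ger0_real /complex_realP [x ->]. Qed.

Lemma Re_conj_add (z : C) : z + z^* = toC (2 * complex.Re z).
Proof.
case: z => a b; apply/eqP; rewrite eq_complex /=.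
by apply/andP; split; apply/eqP; ring.
Qed.

Lemma blkop_tr_le (T : finType) (A X B : Op R T) : psd (blkop A X B) ->
  complex.Re (tr X) <= trnorm (opmul (psd_sqrt A) (psd_sqrt B)).
Proof.
move=> /psd_blkop h.
have /psdmx_mxop hA := blkpsd_l h; have /psdmx_mxop hB := blkpsd_r h.
have [a0 eA] := psd_sqrtP hA; have [b0 eB] := psd_sqrtP hB.
set M := opmul (psd_sqrt A) (psd_sqrt B).
have hM : psd (opmul (adj M) M).
  by apply/psdmx_mxop; rewrite mxop_mul mxop_adj; apply: psdmx_gram.
have [s0 eS] := psd_sqrtP hM.
have := @blkpsd_tr_le _ _ _ _ _ (mxop (psd_sqrt A)) (mxop (psd_sqrt B))
  (mxop (psd_sqrt (opmul (adj M) M))) h.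
rewrite -!mxop_mul -mxop_adj -!mxop_mul eA eB eS !mxtrace_mxop.
have /= -> := ge0_toC (psd_tr_ge0 s0); rewrite Re_conj_add.
move=> /(_ ((psdmx_mxop _).2 a0) erefl ((psdmx_mxop _).2 b0) erefl ((psdmx_mxop _).2 s0) erefl).
rewrite -/(trnorm M) /toC lecE /= => /andP[_].
by lra.
Qed.

Lemma blkop_tr_attained (T : finType) (A B : Op R T) : psd A -> psd B ->
  exists X, psd (blkop A X B) /\
    tr X = toC (trnorm (opmul (psd_sqrt A) (psd_sqrt B))).
Proof.
move=> hA hB.
have [a0 eA] := psd_sqrtP hA; have [b0 eB] := psd_sqrtP hB.
set M := opmul (psd_sqrt A) (psd_sqrt B).
have hM : psd (opmul (adj M) M).
  by apply/psdmx_mxop; rewrite mxop_mul mxop_adj; apply: psdmx_gram.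
have [s0 eS] := psd_sqrtP hM.
have := @blkpsd_tr_attained _ _ (mxop A) (mxop B) (mxop (psd_sqrt A)) (mxop (psd_sqrt B))
  (mxop (psd_sqrt (opmul (adj M) M))).
rewrite -!mxop_mul -mxop_adj -!mxop_mul eA eB eS.
move=> /(_ ((psdmx_mxop _).2 a0) erefl ((psdmx_mxop _).2 b0) erefl ((psdmx_mxop _).2 s0) erefl).
move=> [X [h1 h2]]; exists (opmx X); split; first by apply/psd_blkop; rewrite opmxK.
by rewrite -mxtrace_mxop opmxK h2 mxtrace_mxop; apply/ge0_toC/psd_tr_ge0.
Qed.

(** * Operations preserving positivity *)

Lemma psd_sum (T I : finType) (M : I -> Op R T) :
  (forall k, psd (M k)) -> psd (fun i j => \sum_k M k i j).
Proof.
move=> h v; have -> : \sum_i \sum_j (v i)^* * (\sum_k M k i j) * v j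
    = \sum_k \sum_i \sum_j (v i)^* * M k i j * v j.
  rewrite [RHS]exchange_big /=; apply: eq_bigr => i _.
  rewrite [RHS]exchange_big /=; apply: eq_bigr => j _.
  by rewrite mulr_sumr mulr_suml.
by apply: sumr_ge0 => k _; apply: h.
Qed.

Lemma psd_add (T : finType) (A B : Op R T) : psd A -> psd B ->
  psd (fun i j => A i j + B i j).
Proof.
move=> hA hB.
have := @psd_sum T bool (fun b => if b then A else B).
rewrite (_ : (fun i j => _) = fun i j => A i j + B i j); last first.
  by apply: opP => i j; rewrite big_bool.
by apply; case.
Qed.

Lemma psd_congr (T1 T2 : finType) (A : Op R T1) (N : T1 -> T2 -> C) : psd A ->
  psd (fun i j => \sum_a \sum_b (N a i)^* * A a b * N b j).
Proof.
move=> hA v; have := hA (fun a => \sum_i N a i * v i).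
congr (0 <= _).
transitivity (\sum_i \sum_j \sum_a \sum_b (N a i * v i)^* * A a b * (N b j * v j)).
  rewrite [RHS](eq_bigr (fun i => \sum_a \sum_b \sum_j
      (N a i * v i)^* * A a b * (N b j * v j))); last first.
    move=> i _; rewrite exchange_big /=; apply: eq_bigr => a _.
    by rewrite exchange_big.
  rewrite [RHS]exchange_big /=; apply: eq_bigr => a _.
  rewrite [RHS]exchange_big /=; apply: eq_bigr => b _.
  rewrite rmorph_sum !mulr_suml; apply: eq_bigr => i _.
  by rewrite mulr_sumr.
apply: eq_bigr => i _; apply: eq_bigr => j _.
rewrite mulr_sumr mulr_suml; apply: eq_bigr => a _.
rewrite mulr_sumr mulr_suml; apply: eq_bigr => b _.
by rewrite rmorphM /=; ring.
Qed.

Lemma sum_delta (T : finType) (t : T) (F : T -> C) :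
  \sum_a (a == t)%:R * F a = F t.
Proof.
rewrite (bigD1 t) //= eqxx mul1r big1 ?addr0 // => a /negPf ->.
by rewrite mul0r.
Qed.

(** Congruence by the matrix whose column [i] has the single entry [c i], in row [g i]. It covers
    relabellings, block compressions and rank-one operators. *)
Lemma psd_scaled_reindex (T1 T2 : finType) (g : T1 -> T2) (c : T1 -> C) (M : Op R T2) :
  psd M -> psd (fun i j => (c i)^* * M (g i) (g j) * c j).
Proof.
move=> /(psd_congr (fun a i => (a == g i)%:R * c i)).
congr psd; apply: opP => i j.
rewrite -[RHS](sum_delta (g i) (fun a => (c i)^* * M a (g j) * c j)).
apply: eq_bigr => a _.
rewrite -[M a (g j)](sum_delta (g j)) mulr_sumr mulr_suml mulr_sumr.
by apply: eq_bigr => b _; rewrite rmorphM /= conjC_nat; ring.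
Qed.

Lemma psd_reindex (T1 T2 : finType) (g : T1 -> T2) (M : Op R T2) :
  psd M -> psd (Defs.reindex g M).
Proof.
move=> /(psd_scaled_reindex g (fun=> 1)); congr psd; apply: opP => i j.
by rewrite rmorph1 mul1r mulr1.
Qed.

Lemma psd_scale (T : finType) (c : C) (M : Op R T) : 0 <= c -> psd M ->
  psd (fun i j => c * M i j).
Proof.
move=> c0 hM v; have -> : \sum_i \sum_j (v i)^* * (c * M i j) * v j
    = c * \sum_i \sum_j (v i)^* * M i j * v j.
  rewrite mulr_sumr; apply: eq_bigr => i _; rewrite mulr_sumr.
  by apply: eq_bigr => j _; ring.
by rewrite mulr_ge0.
Qed.

Lemma psd_idop (T : finType) : psd (@idop R T).
Proof.
move=> v; apply: sumr_ge0 => i _.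
rewrite (eq_bigr (fun j => (j == i)%:R * ((v i)^* * v j))); last first.
  by move=> j _; rewrite /idop eq_sym; ring.
by rewrite (sum_delta i) mulrC mul_conjC_ge0.
Qed.

Lemma psd_ketbra (T : finType) (v : Vec R T) : psd (ketbra v).
Proof.
have := @psd_scaled_reindex T unit (fun=> tt) (fun t => (v t)^*) _ (@psd_idop unit).
congr psd; apply: opP => i j; rewrite /idop eqxx mulr1 conjCK.
by [].
Qed.

(** Writing [A = a^* a] turns [A (x) B] into a sum over the rows of [a] of scaled reindexings of
    [B]. *)
Lemma psd_tens (T1 T2 : finType) (A : Op R T1) (B : Op R T2) :
  psd A -> psd B -> psd (tens A B).
Proof.
move=> hA hB; have [ha eA] := psd_sqrtP hA; have ah := psd_herm ha.
move: (psd_sqrt A) ha eA ah => a ha eA ah.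
have := psd_sum (fun m => psd_scaled_reindex snd (fun i : T1 * T2 => a m i.1) hB).
congr psd; apply: opP => i j; rewrite /tens -eA /opmul mulr_suml.
apply: eq_bigr => m _.
have -> : a i.1 m = (a m i.1)^* by rewrite -{1}ah.
by rewrite mulrAC.
Qed.

Lemma psd_ptr2 (T1 T2 : finType) (M : Op R (T1 * T2)) : psd M -> psd (ptr2 M).
Proof. by move=> hM; apply: psd_sum => k; apply: (psd_reindex (fun i => (i, k)) hM). Qed.

(** Complete positivity is stated for ancillas ['I_n]; enumerating [Z] extends it to any finite
    ancilla. *)
Lemma channel_ext_id_psd (Z T1 T2 : finType) (F : Op R T1 -> Op R T2)
  (M : Op R (Z * T1)) : channel F -> psd M -> psd (ext_id F M).
Proof.
move=> [_ _ cp] hM.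
have := cp _ _ (psd_reindex (fun p : 'I_#|Z| * T1 => (enum_val p.1, p.2)) hM).
move=> /(psd_reindex (fun p : Z * T2 => (enum_rank p.1, p.2))).
congr psd; apply: opP => i j; rewrite /Defs.reindex /ext_id /=.
by rewrite !enum_rankK.
Qed.

Lemma linmap_sum (T1 T2 I : finType) (F : Op R T1 -> Op R T2) (M : I -> Op R T1) :
  linmap F -> F (fun i j => \sum_k M k i j) = fun i j => \sum_k F (M k) i j.
Proof.
move=> lF.
have F0 : F (fun _ _ => 0) = fun _ _ => 0.
  have := lF (- 1) (fun _ _ => 0) (fun _ _ => 0).
  rewrite (_ : (fun _ _ => - 1 * 0 + 0) = fun _ _ => 0); last first.
    by apply: opP => i j; ring.
  by move=> ->; apply: opP => i j; ring.
suff h s : F (fun i j => \sum_(k <- s) M k i j) = fun i j => \sum_(k <- s) F (M k) i j.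
  exact: h.
elim: s => [|k s IH].
  rewrite (_ : (fun i j => _) = fun _ _ => 0); last by apply: opP => i j; rewrite big_nil.
  by rewrite F0; apply: opP => i j; rewrite big_nil.
rewrite (_ : (fun i j => _) = fun i j => 1 * M k i j + \sum_(k <- s) M k i j); last first.
  by apply: opP => i j; rewrite big_cons mul1r.
by rewrite lF IH; apply: opP => i j; rewrite big_cons mul1r.
Qed.

Lemma linmap_scale (T1 T2 : finType) (F : Op R T1 -> Op R T2) c (M : Op R T1) :
  linmap F -> F (fun i j => c * M i j) = fun i j => c * F M i j.
Proof.
move=> lF; have := lF (c - 1) M M.
rewrite (_ : (fun i j => _ * M i j + M i j) = fun i j => c * M i j); last first.
  by apply: opP => i j; ring.
by move=> ->; apply: opP => i j; ring.
Qed.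

Lemma linmap_sub (T1 T2 : finType) (F : Op R T1 -> Op R T2) (M N : Op R T1) :
  linmap F -> F (fun i j => M i j - N i j) = fun i j => F M i j - F N i j.
Proof.
move=> lF; have := lF (- 1) N M.
rewrite (_ : (fun i j => _ * N i j + M i j) = fun i j => M i j - N i j); last first.
  by apply: opP => i j; ring.
by move=> ->; apply: opP => i j; ring.
Qed.

Lemma blkop_psdE (T : finType) (M : Op R (bool * T)) : psd M ->
  M = blkop (fun i j => M (false, i) (false, j)) (fun i j => M (false, i) (true, j))
            (fun i j => M (true, i) (true, j)).
Proof.
move=> /psd_herm hM; apply: opP => -[[] i] [[] j] //.
by rewrite -{1}hM.
Qed.

(** With the qubit as ancilla, a completely positive map sends couplings to couplings. If it also
    preserves [tr X], this is monotonicity of the fidelity. *)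
Lemma blkop_map (T1 T2 : finType) (F : Op R T1 -> Op R T2) (A X B : Op R T1) :
  (forall M : Op R (bool * T1), psd M -> psd (ext_id F M)) ->
  psd (blkop A X B) -> psd (blkop (F A) (F X) (F B)).
Proof.
by move=> hF /hF h; have := h; rewrite (blkop_psdE h).
Qed.

Lemma blkopC (T : finType) (A X B : Op R T) : psd (blkop A X B) -> psd (blkop B (adj X) A).
Proof. by rewrite !psd_blkop mxop_adj; apply: blkpsdC. Qed.

Lemma blkop_l (T : finType) (A X B : Op R T) : psd (blkop A X B) -> psd A.
Proof. by move=> /psd_blkop /blkpsd_l /psdmx_mxop. Qed.

Lemma blkop_r (T : finType) (A X B : Op R T) : psd (blkop A X B) -> psd B.
Proof. by move=> /psd_blkop /blkpsd_r /psdmx_mxop. Qed.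

Lemma blkop_schur (T : finType) (A X B : Op R T) : psd (blkop A X B) ->
  exists K D, [/\ X = opmul A K, psd D &
    B = fun i j => opmul (adj K) (opmul A K) i j + D i j].
Proof.
move=> /psd_blkop /blkpsd_schur [K [XE hD]].
set D := _ - _ in hD.
exists (opmx K), (opmx D); split.
- by apply: mxop_inj; rewrite mxop_mul opmxK.
- by apply/psdmx_mxop; rewrite opmxK.
apply: mxop_inj.
transitivity (mxop (opmul (adj (opmx K)) (opmul A (opmx K))) + mxop (opmx D)).
  by rewrite !mxop_mul mxop_adj !opmxK /D mulmxA addrC subrK.
by apply/matrixP => i j; rewrite !mxE.
Qed.

Lemma blkop_factor (T : finType) (A K D : Op R T) : psd A -> psd D ->
  psd (blkop A (opmul A K) (fun i j => opmul (adj K) (opmul A K) i j + D i j)).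
Proof.
move=> /psdmx_mxop hA /psdmx_mxop hD; apply/psd_blkop.
rewrite mxop_mul.
have -> : mxop (fun i j => opmul (adj K) (opmul A K) i j + D i j)
    = (mxop K)^t* *m mxop A *m mxop K + mxop D.
  rewrite -mulmxA -mxop_adj -!mxop_mul.
  by apply/matrixP => i j; rewrite [RHS]mxE [LHS]mxE; congr (_ + _); rewrite mxE.
exact: blkpsd_factor.
Qed.

(** * Partial traces and the extension of couplings *)

Definition ptr1 (T1 T2 : finType) (M : Op R (T1 * T2)) : Op R T2 :=
  fun i j => \sum_k M (k, i) (k, j).

Lemma sum_pair (T1 T2 : finType) (F : T1 * T2 -> C) :
  \sum_p F p = \sum_a \sum_b F (a, b).
Proof. by rewrite (pair_bigA _ (fun a b => F (a, b))); apply: eq_bigr => -[]. Qed.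

Lemma tr_ptr1 (T1 T2 : finType) (M : Op R (T1 * T2)) : tr (ptr1 M) = tr M.
Proof. by rewrite /tr sum_pair exchange_big. Qed.

Lemma opmul_tens_idop (T1 T2 : finType) (M : Op R (T1 * T2)) (K : Op R T2) i j :
  opmul M (tens (@idop R T1) K) i j = \sum_b M i (j.1, b) * K b j.2.
Proof.
rewrite /opmul sum_pair exchange_big /=; apply: eq_bigr => b _.
rewrite -(sum_delta j.1 (fun a => M i (a, b) * K b j.2)).
by apply: eq_bigr => a _; rewrite /tens /idop /=; ring.
Qed.

Lemma opmul_tens_idop_adj (T1 T2 : finType) (M : Op R (T1 * T2)) (K : Op R T2) i j :
  opmul (adj (tens (@idop R T1) K)) M i j = \sum_b adj K i.2 b * M (i.1, b) j.
Proof.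
rewrite /opmul sum_pair exchange_big /=; apply: eq_bigr => b _.
rewrite -(sum_delta i.1 (fun a => adj K i.2 b * M (a, b) j)).
by apply: eq_bigr => a _; rewrite /adj /tens /idop /= rmorphM /= conjC_nat; ring.
Qed.

(* Uhlmann's theorem without purifications: a coupling [X] of the marginal of
   [w] with [B] lifts to a coupling of [w] with some extension of [B]. *)
Lemma coupling_extension (T1 T2 : finType) (t0 : T1) (w : Op R (T1 * T2)) (X B : Op R T2) :
  psd w -> psd (blkop (ptr1 w) X B) ->
  exists Xw wB, [/\ psd (blkop w Xw wB), tr Xw = tr X, ptr1 wB = B &
    (forall a b i j, a != b -> w (a, i) (b, j) = 0) ->
    forall a b i j, a != b -> wB (a, i) (b, j) = 0].
Proof.
move=> hw /blkop_schur [K [D [-> hD ->]]].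
pose K' := tens (@idop R T1) K.
(* The Schur defect [D] is placed on one basis state of the first register: its marginal is still
   [D], and it is block diagonal there, which keeps classical registers classical. *)
pose D' := tens (ketbra (fun t : T1 => (t == t0)%:R)) D.
have hD' : psd D' by apply: psd_tens => //; apply: psd_ketbra.
have ptrX : ptr1 (opmul w K') = opmul (ptr1 w) K.
  apply: opP => i j; rewrite /ptr1 /opmul.
  rewrite (eq_bigr (fun t => \sum_b w (t, i) (t, b) * K b j)); last first.
    by move=> t _; rewrite -/(opmul w K' _ _) opmul_tens_idop.
  by rewrite exchange_big; apply: eq_bigr => b _; rewrite mulr_suml.
exists (opmul w K'), (fun i j => opmul (adj K') (opmul w K') i j + D' i j); split.
- exact: blkop_factor.
- by rewrite -tr_ptr1 ptrX.
- apply: opP => i j; rewrite {1}/ptr1 big_split /=; congr (_ + _).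
    rewrite -ptrX (eq_bigr (fun t => \sum_b adj K i b * opmul w K' (t, b) (t, j))).
      by rewrite exchange_big; apply: eq_bigr => b _; rewrite -mulr_sumr.
    by move=> t _; rewrite opmul_tens_idop_adj.
  rewrite (eq_bigr (fun t => (t == t0)%:R * ((t == t0)%:R * D i j))); last first.
    by move=> t _; rewrite /D' /tens /ketbra /= conjC_nat; ring.
  by rewrite sum_delta eqxx mul1r.
move=> cl a b i j ab; rewrite opmul_tens_idop_adj big1 ?add0r.
  rewrite /D' /tens /ketbra /= conjC_nat; have [e|_] := eqVneq a t0; last by rewrite !mul0r.
  by rewrite -e eq_sym (negPf ab) mulr0 mul0r.
move=> k _; rewrite opmul_tens_idop big1 ?mulr0 // => l _.
by rewrite cl // mul0r.
Qed.

(** The block diagonal part of [w] is below [1 (x) ptr1 w]: in block [k] the difference is the sum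
    of the other diagonal blocks, selected by [c]. *)
Lemma pinching (T1 T2 : finType) (w : Op R (T1 * T2)) : psd w ->
  psd (fun i j => (i.1 == j.1)%:R * (ptr1 w i.2 j.2 - w i j)).
Proof.
move=> hw.
pose c (a k : T1) : C := (a != k)%:R.
have h (k : T1) := psd_sum (fun a => psd_scaled_reindex (fun i => (a, i.2))
  (fun i : T1 * T2 => (i.1 == k)%:R * c a k) hw).
have := psd_sum h; congr psd; apply: opP => -[q i] [r j] /=.
rewrite -(sum_delta q (fun k => (k == r)%:R * (ptr1 w i j - w (q, i) (r, j)))).
apply: eq_bigr => k _.
rewrite [k == q]eq_sym [k == r]eq_sym.
case: (eqVneq q k) => [<-|_]; last first.
  by rewrite !mul0r big1 // => a _; rewrite !mul0r rmorph0 !mul0r.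
case: (eqVneq r q) => [->|_]; last first.
  by rewrite !mul0r mulr0 big1 // => a _; rewrite !mul0r mulr0.
rewrite !mul1r /ptr1 (bigD1 q) //= [in RHS](bigD1 q) //= addrAC subrr add0r.
rewrite /c eqxx /= mulr0 mulr0 add0r.
by apply: eq_bigr => a aq; rewrite aq mulr1 rmorph1 mulr1 mul1r.
Qed.

(** Pinching inequality: [w] is at most [#|T1|] times its block diagonal part, the difference being
    half the sum over [k, l] of [(P_k - P_l) w (P_k - P_l)], with [P_k] the basis projections of the
    first register. *)
Lemma pinching_card (T1 T2 : finType) (w : Op R (T1 * T2)) : psd w ->
  psd (fun i j => (#|T1|%:R * (i.1 == j.1)%:R - 1) * w i j).
Proof.
move=> hw.
have h (k l : T1) := psd_scaled_reindex id
  (fun i : T1 * T2 => (k == i.1)%:R - (l == i.1)%:R) hw.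
have := psd_scale (c := 2^-1) _ (psd_sum (fun k => psd_sum (h k))).
rewrite invr_ge0 ler0n => /(_ isT); congr psd; apply: opP => -[q i] [r j] /=.
have S1 (t : T1) : \sum_k (k == t)%:R = 1 :> C.
  by rewrite -[RHS](sum_delta t (fun=> 1)); apply: eq_bigr => k _; rewrite mulr1.
have S2 : \sum_k (k == q)%:R * (k == r)%:R = (q == r)%:R :> C by rewrite sum_delta.
have E k l : ((k == q)%:R - (l == q)%:R)^* * w (q, i) (r, j) *
    ((k == r)%:R - (l == r)%:R) = w (q, i) (r, j) * ((k == q)%:R * (k == r)%:R)
    + w (q, i) (r, j) * ((l == q)%:R * (l == r)%:R)
    - w (q, i) (r, j) * (k == q)%:R * (l == r)%:R
    - w (q, i) (r, j) * (k == r)%:R * (l == q)%:R.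
  by rewrite rmorphB /= !conjC_nat; ring.
transitivity (2^-1 * \sum_(k : T1) (#|T1|%:R * (w (q, i) (r, j) * ((k == q)%:R * (k == r)%:R))
    + w (q, i) (r, j) * (q == r)%:R
    - w (q, i) (r, j) * (k == q)%:R - w (q, i) (r, j) * (k == r)%:R)).
  congr (_ * _); apply: eq_bigr => k _.
  rewrite (eq_bigr _ (fun l _ => E k l)) !big_split /= !sumrN -!mulr_sumr !S1 S2.
  by rewrite sumr_const -mulr_natl; ring.
rewrite !big_split /= !sumrN -!mulr_sumr !S1 S2 sumr_const -mulr_natl.
by field.
Qed.

(** Put [f_i = cos t_i] and [s_i = sin t_i]. The hypotheses give [F >= cos (t1 + t2)], and the claim
    follows from [sin (t1 + t2) <= s1 + s2]. *)
Lemma fidelity_angle_ineq (F f1 f2 g : R) : 0 <= F -> 0 <= f1 -> 0 <= f2 ->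
  f1 ^+ 2 <= 1 -> f2 ^+ 2 <= 1 -> g ^+ 2 <= (1 - f1 ^+ 2) * (1 - f2 ^+ 2) ->
  f1 * f2 + g <= F ->
  Num.sqrt (1 - F ^+ 2) <= Num.sqrt (1 - f1 ^+ 2) + Num.sqrt (1 - f2 ^+ 2).
Proof.
move=> F0 f10 f20 l1 l2 hg hF.
set s1 := Num.sqrt (1 - f1 ^+ 2); set s2 := Num.sqrt (1 - f2 ^+ 2).
have s10 : 0 <= s1 by apply: sqrtr_ge0.
have s20 : 0 <= s2 by apply: sqrtr_ge0.
have e1 : s1 ^+ 2 = 1 - f1 ^+ 2 by rewrite sqr_sqrtr // subr_ge0.
have e2 : s2 ^+ 2 = 1 - f2 ^+ 2 by rewrite sqr_sqrtr // subr_ge0.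
have f11 : f1 <= 1 by rewrite -(@ler_pXn2r _ 2) ?nnegrE // expr1n.
have f21 : f2 <= 1 by rewrite -(@ler_pXn2r _ 2) ?nnegrE // expr1n.
have gs : `|g| <= s1 * s2.
  rewrite -(@ler_pXn2r _ 2) ?nnegrE ?mulr_ge0 // exprMn e1 e2.
  by rewrite real_normK ?num_real.
apply: (@le_trans _ _ (Num.sqrt ((s1 + s2) ^+ 2))); last first.
  by rewrite sqrtr_sqr ger0_norm // addr_ge0.
rewrite ler_sqrt ?sqr_ge0 //.
move: gs; rewrite ler_norml => /andP[gl _].
have [le|lt] := lerP (s1 * s2) (f1 * f2).
  have hF2 : (f1 * f2 - s1 * s2) ^+ 2 <= F ^+ 2.
    by rewrite ler_pXn2r ?nnegrE ?subr_ge0 //; lra.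
  have : (s1 * f2 + f1 * s2) ^+ 2 <= (s1 + s2) ^+ 2.
    rewrite ler_pXn2r ?nnegrE ?addr_ge0 ?mulr_ge0 //.
    by rewrite lerD // ?ler_piMr ?ler_piMl.
  suff : 1 = (f1 * f2 - s1 * s2) ^+ 2 + (s1 * f2 + f1 * s2) ^+ 2 by lra.
  transitivity ((s1 ^+ 2 + f1 ^+ 2) * (s2 ^+ 2 + f2 ^+ 2)); last by ring.
  by rewrite e1 e2; ring.
(* Here [cos (t1 + t2) < 0], and this inequality amounts to [1 <= s1^2 + s2^2], so the right-hand
   side is already at least [1]. *)
have : (f1 * f2) ^+ 2 <= (s1 * s2) ^+ 2.
  by rewrite ler_pXn2r ?nnegrE ?mulr_ge0 // ltW.
have : 0 <= s1 * s2 by apply: mulr_ge0.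
have : 0 <= F ^+ 2 by apply: sqr_ge0.
rewrite !exprMn e1 e2 sqrrD e1 e2.
by lra.
Qed.

Lemma trnorm_ge0 (T : finType) (A B : Op R T) : psd A -> psd B ->
  0 <= trnorm (opmul (psd_sqrt A) (psd_sqrt B)).
Proof.
move=> hA hB; set M := opmul _ _.
have hM : psd (opmul (adj M) M).
  by apply/psdmx_mxop; rewrite mxop_mul mxop_adj; apply: psdmx_gram.
have [s0 _] := psd_sqrtP hM; have := psd_tr_ge0 s0.
by rewrite lecE => /andP[].
Qed.

Lemma fid_normalized_r (T : finType) (A B : Op R T) : tr B = 1 ->
  fid A B = trnorm (opmul (psd_sqrt A) (psd_sqrt B)).
Proof. by move=> h; rewrite /fid h /= subrr mulr0 sqrtr0 addr0. Qed.

(** Triangle inequality through the middle state [B], for arbitrary couplings with real nonnegative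
    traces rather than only for optimal ones. *)
Lemma Pdist_glue (T : finType) (A B D X1 X2 : Op R T) (f1 f2 : R) :
  psd (blkop B X1 A) -> psd (blkop B X2 D) -> tr B = 1 -> tr A <= 1 -> tr D = 1 ->
  tr X1 = toC f1 -> tr X2 = toC f2 -> 0 <= f1 -> 0 <= f2 ->
  Pdist A D <= Num.sqrt (1 - f1 ^+ 2) + Num.sqrt (1 - f2 ^+ 2).
Proof.
move=> h1 h2 tB tA tD e1 e2 p1 p2.
have cr (x : R) : toC x \is Num.real by rewrite complex_real.
have := @blkpsd_glue _ _ (mxop A) (mxop B) (mxop D) (mxop X1) (mxop X2) (toC f1) (toC f2).
rewrite !mxtrace_mxop => /(_ ((psd_blkop _ _ _).1 h1) ((psd_blkop _ _ _).1 h2) tB tA).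
rewrite {1}tD => /(_ (lexx _) e1 e2 (cr _) (cr _)) [Z [g [hZ tZ gr gle [l1 l2]]]].
have toCX (x : R) : toC x ^+ 2 = toC (x ^+ 2) by rewrite /toC -!/(real_complex R _) rmorphXn.
have {}hZ : psd (blkop A (opmx Z) D) by apply/psd_blkop; rewrite opmxK.
have tZE : \tr Z = tr (opmx Z) by rewrite -mxtrace_mxop opmxK.
move/complex_realP: gr => [g' ge]; subst g.
move: tZ; rewrite tZE Re_conj_add.
rewrite (_ : 2 * (_ + _) = toC (2 * (f1 * f2 + g'))); last first.
  by apply/eqP; rewrite eq_complex /=; apply/andP; split; apply/eqP; ring.
move=> [tZ].
have hF := blkop_tr_le hZ.
rewrite /Pdist fid_normalized_r //.
apply: (@fidelity_angle_ineq _ f1 f2 g') => //.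
- by apply: trnorm_ge0; [apply: blkop_l hZ | apply: blkop_r hZ].
- by move: l1; rewrite toCX lecE /= => /andP[].
- by move: l2; rewrite toCX lecE /= => /andP[].
- by move: gle; rewrite !toCX lecE /= => /andP[_]; rewrite !expr2; lra.
- by lra.
Qed.

Lemma psd_apply_left (T1 T2 Z : finType) (F : Op R T1 -> Op R T2) (M : Op R (T1 * Z)) :
  channel F -> psd M -> psd (apply_left F M).
Proof.
move=> hF hM.
have h := channel_ext_id_psd hF (psd_reindex (fun p : Z * T1 => (p.2, p.1)) hM).
exact: (psd_reindex (fun p : T2 * Z => (p.2, p.1)) h).
Qed.

Lemma channel_psd (T1 T2 : finType) (F : Op R T1 -> Op R T2) (M : Op R T1) :
  channel F -> psd M -> psd (F M).
Proof.
move=> hF hM.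
have h := channel_ext_id_psd hF (psd_reindex (fun p : unit * T1 => p.2) hM).
exact: (psd_reindex (fun t : T2 => (tt, t)) h).
Qed.

Lemma tr_ptr2 (T1 T2 : finType) (M : Op R (T1 * T2)) : tr (ptr2 M) = tr M.
Proof. by rewrite /tr sum_pair. Qed.

Lemma tr_tens (T1 T2 : finType) (A : Op R T1) (B : Op R T2) :
  tr (tens A B) = tr A * tr B.
Proof.
rewrite /tr sum_pair mulr_suml; apply: eq_bigr => a _.
by rewrite mulr_sumr.
Qed.

Lemma tr_idop (T : finType) : tr (@idop R T) = #|T|%:R.
Proof.
rewrite /tr (eq_bigr (fun=> 1)) ?sumr_const // => i _.
by rewrite /idop eqxx.
Qed.

Lemma tr_adj (T : finType) (A : Op R T) : tr (adj A) = (tr A)^*.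
Proof. by rewrite /tr rmorph_sum. Qed.

Lemma psd_ptr1 (T1 T2 : finType) (M : Op R (T1 * T2)) : psd M -> psd (ptr1 M).
Proof. by move=> hM; apply: psd_sum => k; apply: (psd_reindex (fun i => (k, i)) hM). Qed.

Lemma conj_toC (x : R) : (toC x)^* = toC x.
Proof. by apply/CrealP; rewrite complex_real. Qed.

Lemma blkop_tens (T1 T2 : finType) (M : Op R T1) (A X B : Op R T2) :
  psd M -> psd (blkop A X B) -> psd (blkop (tens M A) (tens M X) (tens M B)).
Proof.
move=> hM h.
have := psd_reindex (fun p : bool * (T1 * T2) => (p.2.1, (p.1, p.2.2))) (psd_tens hM h).
by move=> h'; have := h'; rewrite (blkop_psdE h').
Qed.

(** * Redistribution protocols *)

Section Protocol.
Variables (S L E P X Y Q : finType).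
Variables (rhoXY : Op R (X * Y)) (psi : Vec R ((S * (L * E)) * P)).
Variables (Enc : Op R ((L * P) * X) -> Op R (P * Q)).
Variables (Dec : Op R ((Q * E) * Y) -> Op R (L * E)).
Hypotheses (hEnc : channel Enc) (hDec : channel Dec).

Definition enc_input : Op R (((L * P) * X) * ((S * E) * Y)) :=
  Defs.reindex (fun t : ((L * P) * X) * ((S * E) * Y) =>
    let '((l, p, x), (s, e, y)) := t in (((s, (l, e)), p), (x, y)))
    (tens (ketbra psi) rhoXY).

(** The state after encoding with Alice's [P] traced out; [Q] comes first so that [ptr1] removes the
    message. *)
Definition enc_state : Op R (Q * (Y * (S * E))) := fun i j =>
  \sum_p apply_left Enc enc_input ((p, i.1), (i.2.2.1, i.2.2.2, i.2.1))
                                  ((p, j.1), (j.2.2.1, j.2.2.2, j.2.1)).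

Definition dec_map (M : Op R (Q * (Y * (S * E)))) : Op R (S * (L * E)) :=
  ext_id Dec (Defs.reindex (fun t : S * ((Q * E) * Y) =>
    (t.2.1.1, (t.2.2, (t.1, t.2.1.2)))) M).

Lemma dec_map_cp (M : Op R (bool * (Q * (Y * (S * E))))) :
  psd M -> psd (ext_id dec_map M).
Proof.
move=> hM.
have h := channel_ext_id_psd hDec (psd_reindex (fun p : (bool * S) * ((Q * E) * Y) =>
  (p.1.1, (p.2.1.1, (p.2.2, (p.1.2, p.2.1.2))))) hM).
exact: (psd_reindex (fun p : bool * (S * (L * E)) => ((p.1, p.2.1), p.2.2)) h).
Qed.

Lemma dec_map_psd (M : Op R (Q * (Y * (S * E)))) : psd M -> psd (dec_map M).
Proof. by move=> hM; apply: channel_ext_id_psd => //; apply: psd_reindex. Qed.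

Lemma tr_dec_map (M : Op R (Q * (Y * (S * E)))) : tr (dec_map M) = tr M.
Proof.
have [_ tp _] := hDec.
rewrite /tr sum_pair.
rewrite (eq_bigr (fun s => \sum_q \sum_e \sum_y M (q, (y, (s, e))) (q, (y, (s, e))))).
  rewrite exchange_big [RHS]sum_pair; apply: eq_bigr => q _.
  rewrite [RHS]sum_pair [RHS]exchange_big [RHS]sum_pair; apply: eq_bigr => s _.
  by [].
move=> s _.
rewrite -[LHS]/(tr (Dec (fun a b => M (a.1.1, (a.2, (s, a.1.2))) (b.1.1, (b.2, (s, b.1.2)))))).
by rewrite tp /tr !sum_pair.
Qed.

(** The decoder does not act on [P], so by linearity tracing out [P] commutes with it. *)
Lemma ptr2_qsr_output : ptr2 (qsr_output psi rhoXY Enc Dec) = dec_map enc_state.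
Proof.
have [lin _ _] := hDec; apply: opP => -[s [l e]] [s' [l' e']].
rewrite /dec_map /ext_id /=.
rewrite (_ : (fun a b => _) = fun a b => \sum_p
    apply_left Enc enc_input ((p, a.1.1), (s, a.1.2, a.2)) ((p, b.1.1), (s', b.1.2, b.2))) //.
rewrite (linmap_sum _ lin); apply: eq_bigr => p _.
rewrite /qsr_output /= /Defs.reindex /apply_left /=.
congr (Dec _ _ _); apply: opP => -[[q1 e1] y1] [[q2 e2] y2] /=.
by [].
Qed.

(** No signalling: the encoder acts on [L P X] only and preserves the trace, so discarding its
    outputs discards its inputs. *)
Lemma ptr1_enc_state :
  ptr1 enc_state = tens (ptr1 rhoXY) (trace_mid (ptr2 (ketbra psi))).
Proof.
have [_ tp _] := hEnc.
apply: opP => -[y [s e]] [y' [s' e']]; rewrite /ptr1 /enc_state /=.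
rewrite exchange_big /= -(sum_pair (fun t => apply_left Enc enc_input (t, (s, e, y)) (t, (s', e', y')))).
rewrite -[LHS]/(tr (Enc (fun a b => enc_input (a, (s, e, y)) (b, (s', e', y'))))) tp.
rewrite /tr !sum_pair /tens /= mulrC /trace_mid /ptr2 mulr_suml.
apply: eq_bigr => l _; rewrite mulr_suml; apply: eq_bigr => p _.
by rewrite mulr_sumr.
Qed.

Lemma psd_enc_state : psd rhoXY -> psd enc_state.
Proof.
move=> hXY; apply: psd_sum => p.
apply: (psd_reindex (fun i : Q * (Y * (S * E)) => ((p, i.1), (i.2.2.1, i.2.2.2, i.2.1)))).
by apply: psd_apply_left => //; apply/psd_reindex/psd_tens => //; apply: psd_ketbra.
Qed.

Lemma psd_qsr_output : psd rhoXY -> psd (qsr_output psi rhoXY Enc Dec).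
Proof.
move=> hXY; apply/psd_reindex/psd_apply_left => //.
apply/psd_reindex/psd_apply_left => //.
by apply/psd_reindex/psd_tens => //; apply: psd_ketbra.
Qed.

Lemma classical_enc_state a b i j : classical_out Enc -> a != b ->
  enc_state (a, i) (b, j) = 0.
Proof. by move=> cl ab; rewrite /enc_state big1 // => p _; apply: cl. Qed.

Lemma tr_trace_mid (rho : Op R (S * (L * E))) : tr (trace_mid rho) = tr rho.
Proof.
rewrite /tr !sum_pair; apply: eq_bigr => s _.
by rewrite exchange_big sum_pair.
Qed.

Variables (rho : Op R (S * (L * E))) (eps delta : R).
Hypotheses (hpsi : ptr2 (ketbra psi) = rho) (hrho : dens_eq rho) (hXY : dens_eq rhoXY).
Hypothesis hdelta : Pdist (ketbra psi) (qsr_output psi rhoXY Enc Dec) <= delta.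

Lemma tr_enc_state : tr enc_state = 1.
Proof.
have [_ t1] := hXY; have [_ t2] := hrho.
by rewrite -tr_ptr1 ptr1_enc_state hpsi tr_tens tr_ptr1 tr_trace_mid t1 t2 mulr1.
Qed.

(** An operator of trace one cannot live on an empty register. *)
Lemma message_inhabited : exists q : Q, True.
Proof.
have [//|/forallNP hQ] := pselect (exists q : Q, True).
have := tr_enc_state; rewrite /tr sum_pair big1 => [/esym/eqP|q _].
  by rewrite oner_eq0.
by case: (hQ q).
Qed.

Lemma message_card_gt0 : (0 < #|Q|)%N.
Proof. by have [q _] := message_inhabited; apply/card_gt0P; exists q. Qed.

(* The decoder's output on the maximally mixed message. *)
Definition dec_guess (sig : Op R E) : Op R (L * E) :=
  Dec (fun a b => #|Q|%:R^-1 * tens (tens (@idop R Q) sig) (ptr1 rhoXY) a b).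

Lemma dec_guess_dens (sig : Op R E) : dens_le sig -> dens_le (dec_guess sig).
Proof.
move=> [s0 s1]; have [xy0 xy1] := hXY; have [_ tp _] := hDec; split.
  have hQ : psd (@idop R Q) by apply: psd_idop.
  have h := psd_tens (psd_tens hQ s0) (psd_ptr1 xy0).
  have c0 : 0 <= #|Q|%:R^-1 :> C by rewrite invr_ge0 ler0n.
  exact: channel_psd hDec (psd_scale c0 h).
rewrite /dec_guess tp /tr -mulr_sumr.
rewrite -/(tr (tens (tens (@idop R Q) sig) (ptr1 rhoXY))) !tr_tens tr_ptr1 xy1 mulr1 tr_idop.
by rewrite mulKf // pnatr_eq0 -lt0n message_card_gt0.
Qed.

(** Two couplings are glued at [dec_map enc_state]: one with [dec_map w], lifted from the smoothing
    of [trace_mid rho], and one with [rho], from the protocol error after tracing out [P]. *)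
Lemma redistribution_coupling (rt : Op R (S * E)) :
  dens_le rt -> Pdist rt (trace_mid rho) <= eps ->
  exists w : Op R (Q * (Y * (S * E))), [/\ psd w,
    ptr1 w = tens (ptr1 rhoXY) rt,
    Pdist (dec_map w) rho <= eps + delta &
    classical_out Enc -> forall a b i j, a != b -> w (a, i) (b, j) = 0].
Proof.
move=> [rt0 rt1] hP; have [xy0 xy1] := hXY; have [r0 r1] := hrho.
set r := trace_mid rho in hP.
have tr1 : tr r = 1 by rewrite tr_trace_mid.
have r0' : psd r.
  by apply: psd_sum => l; apply: (psd_reindex (fun i : S * E => (i.1, (l, i.2))) r0).
have [X1 [hX1 tX1]] := blkop_tr_attained rt0 r0'.
rewrite -fid_normalized_r // in tX1.
have [t0 _] := message_inhabited.
have hwe := psd_enc_state xy0.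
have hblk : psd (blkop (ptr1 enc_state) (tens (ptr1 rhoXY) (adj X1)) (tens (ptr1 rhoXY) rt)).
  rewrite ptr1_enc_state hpsi; apply: blkop_tens; first exact: psd_ptr1.
  exact: blkopC.
have [Xw [w [hw tXw pw clw]]] := coupling_extension t0 hwe hblk.
have hout := psd_qsr_output xy0.
have tout : tr (qsr_output psi rhoXY Enc Dec) = 1.
  by rewrite -tr_ptr2 ptr2_qsr_output tr_dec_map tr_enc_state.
have [X2 [hX2 tX2]] := blkop_tr_attained (psd_ketbra psi) hout.
rewrite -fid_normalized_r // in tX2.
have hX2' : psd (blkop (dec_map enc_state) (adj (ptr2 X2)) rho).
  apply: blkopC; rewrite -hpsi -ptr2_qsr_output.
  apply: blkop_map hX2 => M hM.
  exact: (psd_ptr2 (psd_reindex (fun p : (bool * (S * (L * E))) * P =>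
    (p.1.1, (p.1.2, p.2))) hM)).
exists w; split=> //; first exact: blkop_r hw.
  apply: (@le_trans _ _ (Pdist rt r + Pdist (ketbra psi) (qsr_output psi rhoXY Enc Dec))).
    rewrite /Pdist; apply: (Pdist_glue (blkop_map dec_map_cp hw) hX2').
    - by rewrite tr_dec_map tr_enc_state.
    - by rewrite tr_dec_map -tr_ptr1 pw tr_tens tr_ptr1 xy1 mul1r.
    - by [].
    - by rewrite tr_dec_map tXw tr_tens tr_ptr1 xy1 mul1r tr_adj tX1; apply: conj_toC.
    - by rewrite tr_adj tr_ptr2 tX2; apply: conj_toC.
    - by rewrite fid_normalized_r //; apply: trnorm_ge0.
    - by rewrite fid_normalized_r //; apply: trnorm_ge0 => //; apply: psd_ketbra.
  by apply: lerD.
by move=> cl; apply: clw => a b i j; apply: classical_enc_state.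
Qed.

(** Adding [c 1_Q (x) rho_Y (x) (mu 1_S (x) sig - rt)] to the first bound leaves
    [c mu 1_Q (x) rho_Y (x) 1_S (x) sig - w], which is then decoded. The factor [#|Q|] undoes the
    normalization in [dec_guess]. *)
Lemma dec_map_bound (w : Op R (Q * (Y * (S * E)))) (rt : Op R (S * E)) (sig : Op R E)
    (c mu : R) : 0 <= c ->
  psd (fun i j => toC c * ((i.1 == j.1)%:R * tens (ptr1 rhoXY) rt i.2 j.2) - w i j) ->
  leop rt (fun i j => toC mu * tens (@idop R S) sig i j) ->
  leop (dec_map w)
    (fun i j => toC (c * #|Q|%:R * mu) * tens (@idop R S) (dec_guess sig) i j).
Proof.
move=> c0 hw hrt; have [xy0 xy1] := hXY; have [lin _ _] := hDec.
have c0' : 0 <= toC c by rewrite /toC lecE /= eqxx.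
have hQ : psd (@idop R Q) by apply: psd_idop.
have h := psd_scale c0' (psd_tens hQ (psd_tens (psd_ptr1 xy0) hrt)).
have := dec_map_psd (psd_add h hw).
rewrite /leop; congr psd; apply: opP => -[s le] [s' le'].
have nQ : #|Q|%:R != 0 :> C by rewrite pnatr_eq0 -lt0n message_card_gt0.
have toCM : toC (c * #|Q|%:R * mu) = toC c * #|Q|%:R * toC mu.
  by rewrite /toC -!/(real_complex R _) !rmorphM /= rmorph_nat.
pose ws (a b : Q * E * Y) := w (a.1.1, (a.2, (s, a.1.2))) (b.1.1, (b.2, (s', b.1.2))).
pose G (a b : Q * E * Y) := #|Q|%:R^-1 * tens (tens (@idop R Q) sig) (ptr1 rhoXY) a b.
pose k : C := toC (c * #|Q|%:R * mu) * (s == s')%:R.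
transitivity (Dec (fun a b => k * G a b - ws a b) le le'); last first.
  by rewrite linmap_sub // (linmap_scale k G lin) /k /tens /idop /= mulrA.
rewrite /dec_map /ext_id; congr (Dec _ _ _).
apply: opP => -[[q e] y] [[q' e'] y'].
rewrite /Defs.reindex /tens /idop /k /G /ws /= toCM /tens /idop /=.
by field.
Qed.

End Protocol.

(** * From operator bounds to smooth min-entropies *)

Lemma Dmax_scale (T T' : finType) (K : R) (r s : Op R T) (r' s' : Op R T') : 0 < K ->
  (forall mu, 0 <= mu -> leop r (fun i j => toC mu * s i j) ->
     leop r' (fun i j => toC (K * mu) * s' i j)) ->
  (Dmax r' s' <= Dmax r s + (log2 K)%:E)%E.
Proof.
move=> K0 h; rewrite /Dmax.
set U : set R := fun mu => 0 <= mu /\ leop r (fun i j => toC mu * s i j).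
set U' : set R := fun mu => 0 <= mu /\ leop r' (fun i j => toC mu * s' i j).
case: (asboolP (exists mu, U mu)) => [[mu0 hmu0]|_]; last by rewrite addye // leey.
have UU mu : U mu -> U' (K * mu) by move=> [m0 hm]; split; [rewrite mulr_ge0 // ltW | apply: h].
have -> : `[< exists mu, U' mu >] by apply/asboolP; exists (K * mu0); apply: UU.
have lbU' : has_lbound U' by exists 0 => mu [].
have lbU : has_lbound U by exists 0 => mu [].
have i0 : 0 <= inf U by apply: lb_le_inf; [exists mu0 | move=> mu []].
have i0' : 0 <= inf U' by apply: lb_le_inf; [exists (K * mu0); apply: UU | move=> mu []].
have le : inf U' <= K * inf U.
  rewrite mulrC -ler_pdivrMr //; apply: lb_le_inf; first by exists mu0.
  move=> mu hmu; rewrite ler_pdivrMr // mulrC; apply: ge_inf => //.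
  exact: UU.
(* If the new infimum is [0], its logarithm is [-oo]; otherwise both infima are positive and
   logarithms may be compared. *)
rewrite /elog2; case: eqVneq => [_|n']; first by rewrite leNye.
have p' : 0 < inf U' by rewrite lt_def n'.
have p : 0 < inf U by rewrite -(pmulr_rgt0 _ K0); apply: lt_le_trans le.
rewrite gt_eqF // -EFinD lee_fin /log2 -mulrDl ler_pM2r; last first.
  by rewrite invr_gt0 ln_gt0 // ltr1n.
by rewrite addrC -lnM // ler_ln // posrE mulr_gt0.
Qed.

(** Each smoothing candidate [rt] has an image [rt'], and each side state [s] an image [s'], at the
    uniform cost [K]; suprema and infima then compare termwise. *)
Lemma Hsmooth_scale (A B A' B' : finType) (K eps eps' : R)
    (r : Op R (A * B)) (r' : Op R (A' * B')) : 0 < K ->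
  (forall rt, dens_le rt -> Pdist rt r <= eps ->
    exists rt', [/\ dens_le rt', Pdist rt' r' <= eps' &
      forall s, dens_le s -> exists s', dens_le s' /\
      forall mu, 0 <= mu -> leop rt (fun i j => toC mu * tens (@idop R A) s i j) ->
        leop rt' (fun i j => toC (K * mu) * tens (@idop R A') s' i j)]) ->
  (Hsmooth eps r - (log2 K)%:E <= Hsmooth eps' r')%E.
Proof.
move=> K0 h; rewrite leeBlDr //; apply: ge_ereal_sup => _ [rt [rt0 hrt] <-].
have [rt' [rt0' hrt' hs]] := h rt rt0 hrt.
apply: (@le_trans _ _ (Hup rt' + (log2 K)%:E)%E); last first.
  by apply: leeD2r; apply: ereal_sup_ubound; exists rt'.
rewrite /Hup; set d := ereal_inf _; set d' := ereal_inf _.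
have -> : (- d' + (log2 K)%:E = - (d' - (log2 K)%:E))%E by rewrite fin_num_oppeB.
rewrite leeN2; apply: le_ereal_inf_tmp => _ [s s0 <-].
have [s' [s0' hmu]] := hs s s0.
rewrite leeBlDr //; apply: (le_trans _ (Dmax_scale K0 hmu)).
by apply: ereal_inf_lbound; exists s'.
Qed.

End Operators.

Theorem mainTheorem1 (R : realType) (S L E P : finType)
  (rho : Op R (S * (L * E))) (psi : Vec R ((S * (L * E)) * P)) (delta : R)
  (X Y Q : finType) (rhoXY : Op R (X * Y))
  (Enc : Op R ((L * P) * X) -> Op R (P * Q))
  (Dec : Op R ((Q * E) * Y) -> Op R (L * E)) :
  dens_eq rho ->
  ptr2 (ketbra psi) = rho ->
  0 <= delta ->
  dens_eq rhoXY ->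
  channel Enc -> channel Dec ->
  Pdist (ketbra psi) (qsr_output psi rhoXY Enc Dec) <= delta ->
  forall eps : R, 0 <= eps -> eps < 1 -> eps + delta < 1 ->
    (Hsmooth eps (trace_mid rho) - (2 * log2 (#|Q|%:R : R))%:E
       <= Hsmooth (eps + delta) rho)%E /\
    (classical_out Enc ->
     (Hsmooth eps (trace_mid rho) - (log2 (#|Q|%:R : R))%:E
       <= Hsmooth (eps + delta) rho)%E).
Proof.
move=> hrho hpsi _ hXY hEnc hDec hdelta eps _ _ _.
have Q0 : 0 < #|Q|%:R :> R.
  by rewrite ltr0n; apply: (message_card_gt0 hEnc hpsi hrho hXY).
have dens w rt : dens_le rt -> psd w -> ptr1 w = tens (ptr1 rhoXY) rt ->
    dens_le (dec_map Dec w).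
  move=> [_ rt1] w0 pw; split; first exact: dec_map_psd.
  have [_ xy1] := hXY.
  by rewrite tr_dec_map // -tr_ptr1 pw tr_tens tr_ptr1 xy1 mul1r.
split=> [|cl].
  (* One factor [#|Q|] comes from the pinching inequality, the other from the maximally mixed
     message in [dec_guess]. *)
  have -> : 2 * log2 (#|Q|%:R : R) = log2 (#|Q|%:R * #|Q|%:R).
    by rewrite /log2 lnM ?posrE //; ring.
  apply: Hsmooth_scale => [|rt rt0 hP]; first exact: mulr_gt0.
  have [w [w0 pw hPw _]] := redistribution_coupling hEnc hDec hpsi hrho hXY hdelta rt0 hP.
  exists (dec_map Dec w); split=> //; first exact: dens pw.
  move=> s s0; exists (dec_guess rhoXY Dec s); split.
    exact: (dec_guess_dens hEnc hDec hpsi hrho hXY).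
  move=> mu _; apply: (dec_map_bound hEnc hDec hpsi hrho hXY (ltW Q0)).
  have cQ : 0 <= #|Q|%:R :> R[i] by rewrite ler0n.
  (* The block diagonal part of [w] cancels in the sum, leaving [w <= #|Q| 1_Q (x) rho_Y (x) rt]. *)
  have := psd_add (psd_scale cQ (pinching w0)) (pinching_card w0).
  congr psd; apply: opP => i j.
  by rewrite -pw /toC -/(real_complex R _) rmorph_nat; ring.
apply: Hsmooth_scale => [//|rt rt0 hP].
have [w [w0 pw hPw clw]] := redistribution_coupling hEnc hDec hpsi hrho hXY hdelta rt0 hP.
exists (dec_map Dec w); split=> //; first exact: dens pw.
move=> s s0; exists (dec_guess rhoXY Dec s); split.
  exact: (dec_guess_dens hEnc hDec hpsi hrho hXY).
move=> mu _ hmu.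
rewrite -[#|Q|%:R]mul1r; apply: (dec_map_bound hEnc hDec hpsi hrho hXY ler01) hmu.
(* A classical message makes [w] equal to its block diagonal part, so [pinching] alone gives the
   bound with [c = 1]. *)
have := pinching w0; congr psd; apply: opP => -[q i] [q' j] /=.
rewrite -pw /toC -/(real_complex R _) rmorph1 mul1r mulrBr.
by have [->|/(clw cl) ->] := eqVneq q q'; rewrite ?mul1r ?mulr0.
Qed.
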